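(* Let $Z=z_1e_1+z_2e_2$, $\mathcal V=\nu_1e_1+\nu_2e_2=\alpha_1+j\alpha_2$ and $\delta=\delta_1e_1+\delta_2e_2=\beta_1+j\beta_2$ be elements of $\mathbb{BC}$ with $\Re(\alpha_1)>|\Im(\alpha_2)|$ and $\Re(\beta_1)+1>|\Im(\beta_2)|$. Then $$\mathcal J_{\mathcal V+\delta}(Z)=\frac{1}{\Gamma_b(\mathcal V)\Gamma_b(\delta)}\left(\frac Z2\right)^{\mathcal V+\delta}\sum_{s=0}^{\infty}\frac{Z^{2s}}{4^s(s!)^2}\int_A\int_D u^{\mathcal V-1}(1-u)^{\delta+s}\,v^{\delta-1}(v-1)^s\,du\,dv,$$ where $A=(A_1(u_1),A_2(u_2))$ and $D=(D_1(v_1),D_2(v_2))$ are the two curves in $\mathbb{BC}$ with $u=u_1e_1+u_2e_2$, $v=v_1e_1+v_2e_2$, $0\le u_1,u_2,v_1,v_2\le1$ ($u$ running over $A$ and $v$ over $D$).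
   Context: Bicomplex numbers: $\mathbb{BC}=\{\lambda_1+j\lambda_2:\lambda_1,\lambda_2\in\mathbb C(i)\}$ with commuting units $i,j$, $i^2=j^2=-1$, $k=ij$, $k^2=1$. Put $e_1=\frac{1+k}{2}$, $e_2=\frac{1-k}{2}$; then $e_1+e_2=1$, $e_l^2=e_l$, $e_1e_2=0$. Every $Z=\lambda_1+j\lambda_2$ has the unique idempotent representation $Z=z_1e_1+z_2e_2$ with $z_1=\lambda_1-i\lambda_2$, $z_2=\lambda_1+i\lambda_2\in\mathbb C(i)$. Powers and Gamma: $Z^{\mathcal V}=z_1^{\nu_1}e_1+z_2^{\nu_2}e_2$, with complex powers $z^\nu=\exp(\nu\log z)$ for a fixed branch of $\log$ used consistently (the real branch for positive reals; at $z=0$ only when the power makes sense). $\Gamma_b(Z)=\Gamma(z_1)e_1+\Gamma(z_2)e_2$, with $1/\Gamma$ read as an entire function. Integration is componentwise: for $D=(D_1,D_2)$ and $g(t)=g_1(t_1)e_1+g_2(t_2)e_2$, $\int_D g(t)\,dt=\left(\int_{D_1}g_1(t_1)dt_1\right)e_1+\left(\int_{D_2}g_2(t_2)dt_2\right)e_2$; here all of $A_1,A_2,D_1,D_2$ are the real interval $[0,1]$, and the double integral is the product of the $u$-integral and the $v$-integral. Bicomplex Bessel function: for $\mathcal V,Z\in\mathbb{BC}$, $$\mathcal J_{\mathcal V}(Z)=\sum_{s=0}^\infty\frac{(-1)^s}{\Gamma_b(\mathcal V+s+1)s!}\left(\frac Z2\right)^{\mathcal V+2s},$$ equivalently $\mathcal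 J_{\mathcal V}(Z)=J_{\nu_1}(z_1)e_1+J_{\nu_2}(z_2)e_2$ with $J_\nu$ the classical Bessel function of the first kind.
   Formalization: Convergence of all the v-integrals is added as a hypothesis (it forces both idempotent components of δ to have positive real part); under the stated Re(β1)+1>|Im(β2)| alone the s=0 integral of v^{δ-1} can diverge, e.g. at δ=0, and the right-hand side is undefined. *)

(* Defs.v *)
From Stdlib Require Import Reals Lra Factorial.
From Coquelicot Require Import Coquelicot.

(* The pair (l1, l2) stands for l1 + j l2. *)
Definition BC : Type := (C * C)%type.

Declare Scope BC_scope.
Delimit Scope BC_scope with BC.
Bind Scope BC_scope with BC.

Definition BCofC (z : C) : BC := (z, RtoC 0).
Definition BCofR (x : R) : BC := BCofC (RtoC x).

Definition BCplus (x y : BC) : BC := (fst x + fst y, snd x + snd y)%C.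
Definition BCopp (x : BC) : BC := (- fst x, - snd x)%C.
Definition BCminus (x y : BC) : BC := BCplus x (BCopp y).
Definition BCmult (x y : BC) : BC :=
  (fst x * fst y - snd x * snd y, fst x * snd y + snd x * fst y)%C.

Infix "+" := BCplus : BC_scope.
Infix "-" := BCminus : BC_scope.
Infix "*" := BCmult : BC_scope.
Notation "- x" := (BCopp x) : BC_scope.

Fixpoint BCpow (x : BC) (n : nat) : BC :=
  match n with
  | O => BCofR 1
  | S m => (x * BCpow x m)%BC
  end.
Infix "^" := BCpow : BC_scope.

Definition bci : BC := BCofC Ci.
Definition bcj : BC := (RtoC 0, RtoC 1).
Definition bck : BC := (bci * bcj)%BC.
Definition bce1 : BC := (BCofR (1 / 2) * (BCofR 1 + bck))%BC.
Definition bce2 : BC := (BCofR (1 / 2) * (BCofR 1 - bck))%BC.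

Definition idem1 (x : BC) : C := (fst x - Ci * snd x)%C.
Definition idem2 (x : BC) : C := (fst x + Ci * snd x)%C.
Definition of_idem (z1 z2 : C) : BC :=
  (BCofC z1 * bce1 + BCofC z2 * bce2)%BC.

Lemma of_idem_idem (x : BC) : of_idem (idem1 x) (idem2 x) = x.
Proof.
destruct x as [[a b] [c d]].
unfold of_idem, idem1, idem2, bce1, bce2, bck, bci, bcj, BCminus, BCplus, BCopp,
  BCmult, BCofR, BCofC; simpl.
apply injective_projections; apply injective_projections; simpl; field.
Qed.

Lemma idem1_of_idem (z1 z2 : C) : idem1 (of_idem z1 z2) = z1.
Proof.
destruct z1 as [a b], z2 as [c d].
unfold of_idem, idem1, bce1, bce2, bck, bci, bcj, BCminus, BCplus, BCopp,
  BCmult, BCofR, BCofC; simpl.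
apply injective_projections; simpl; field.
Qed.

Lemma idem2_of_idem (z1 z2 : C) : idem2 (of_idem z1 z2) = z2.
Proof.
destruct z1 as [a b], z2 as [c d].
unfold of_idem, idem2, bce1, bce2, bck, bci, bcj, BCminus, BCplus, BCopp,
  BCmult, BCofR, BCofC; simpl.
apply injective_projections; simpl; field.
Qed.

Definition Cexp (z : C) : C :=
  (exp (fst z) * cos (snd z), exp (fst z) * sin (snd z))%R.

(* No continuity is required: the branch cut may be anywhere off the positive
   half-line. *)
Definition is_log_branch (log : C -> C) : Prop :=
  (forall z : C, z <> RtoC 0 -> Cexp (log z) = z) /\
  (forall x : R, (0 < x)%R -> log (RtoC x) = RtoC (ln x)).

(* At z = 0 the power makes sense when nu = 0 (value 1) or Re nu > 0 (value 0);
   the value 0 in the remaining cases is a dummy. *)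
Definition Cpower (log : C -> C) (z nu : C) : C :=
  if Ceq_dec z (RtoC 0)
  then (if Ceq_dec nu (RtoC 0) then RtoC 1 else RtoC 0)
  else Cexp (nu * log z)%C.

Definition BCpower (log : C -> C) (Z V : BC) : BC :=
  of_idem (Cpower log (idem1 Z) (idem1 V)) (Cpower log (idem2 Z) (idem2 V)).

(* The hypothesis is_log_branch is satisfiable: the principal branch. *)
Definition Cln (z : C) : C :=
  (ln (Cmod z),
   if Rle_dec 0 (snd z) then acos (fst z / Cmod z) else - acos (fst z / Cmod z))%R.

Lemma Cln_is_log_branch : is_log_branch Cln.
Proof.
split.
- intros z Hz; destruct z as [x y].
  assert (Hm : (0 < Cmod (x, y))%R) by now apply Cmod_gt_0.
  assert (Hsq : (Cmod (x, y) * Cmod (x, y) = x * x + y * y)%R).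
  { unfold Cmod; simpl; rewrite sqrt_sqrt; nra. }
  unfold Cexp, Cln; simpl.
  set (m := Cmod (x, y)) in *.
  assert (Hb : (-1 <= x / m <= 1)%R).
  { split; apply Rmult_le_reg_r with m; try assumption; unfold Rdiv;
    rewrite Rmult_assoc, Rinv_l, Rmult_1_r by lra; nra. }
  assert (Hs : sin (acos (x / m)) = (Rabs y / m)%R).
  { rewrite sin_acos by assumption.
    rewrite <- (sqrt_Rsqr (Rabs y / m)).
    - f_equal; unfold Rsqr.
      replace (Rabs y / m * (Rabs y / m))%R
        with ((Rabs y * Rabs y) / (m * m))%R by (field; lra).
      rewrite <- Rabs_mult, Rabs_pos_eq by nra.
      replace (y * y)%R with (m * m - x * x)%R by lra.
      field; lra.
    - apply Rmult_le_pos; [apply Rabs_pos | left; now apply Rinv_0_lt_compat]. }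
  rewrite exp_ln by assumption.
  destruct (Rle_dec 0 y) as [Hy | Hy].
  + rewrite cos_acos, Hs by assumption.
    rewrite Rabs_pos_eq by assumption.
    apply injective_projections; simpl; field; lra.
  + rewrite cos_neg, sin_neg, cos_acos, Hs by assumption.
    rewrite Rabs_left by lra.
    apply injective_projections; simpl; field; lra.
- intros x Hx; unfold Cln; simpl.
  rewrite Cmod_R, Rabs_pos_eq by lra.
  destruct (Rle_dec 0 0) as [_ | H]; [ | lra].
  replace (x / x)%R with 1%R by (field; lra).
  now rewrite acos_1.
Qed.

Fixpoint Crising (z : C) (n : nat) : C :=
  match n with
  | O => RtoC 1
  | S m => (Crising z m * (z + RtoC (INR m)))%C
  end.

(* 1 / Gamma(z) = lim z (z+1) ... (z+n) / (n! n^z) (Euler, Gauss): an entire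
   function of z, vanishing at the poles of Gamma. *)
Definition Cgauss (z : C) (n : nat) : C :=
  (Crising z (S n) * Cexp (- z * RtoC (ln (INR n))) / RtoC (INR (fact n)))%C.

Definition Crgamma (z : C) : C :=
  iota (fun l : C_CompleteNormedModule =>
          filterlim (Cgauss z) eventually (locally l)).

Definition BCrgamma (Z : BC) : BC :=
  of_idem (Crgamma (idem1 Z)) (Crgamma (idem2 Z)).

(* Improper Riemann integrals at both end points. *)
Definition Cex_int01 (f : R -> C) : Prop :=
  ex_RInt_gen (V := C_R_CompleteNormedModule) f (at_right 0) (at_left 1).
Definition Cint01 (f : R -> C) : C :=
  RInt_gen (V := C_R_CompleteNormedModule) f (at_right 0) (at_left 1).

(* For g (t1 e1 + t2 e2) = g1 t1 e1 + g2 t2 e2, the functions g1 and g2 are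
   recovered on the diagonal t1 = t2. *)
Definition comp1 (g : BC -> BC) (t : R) : C := idem1 (g (of_idem (RtoC t) (RtoC t))).
Definition comp2 (g : BC -> BC) (t : R) : C := idem2 (g (of_idem (RtoC t) (RtoC t))).

Definition BCex_int01 (g : BC -> BC) : Prop :=
  Cex_int01 (comp1 g) /\ Cex_int01 (comp2 g).
Definition BCint01 (g : BC -> BC) : BC :=
  of_idem (Cint01 (comp1 g)) (Cint01 (comp2 g)).

Definition BCex_series (a : nat -> BC) : Prop :=
  @ex_series C_AbsRing
    (prod_NormedModule C_AbsRing C_NormedModule C_NormedModule) a.

Definition CSeries (a : nat -> C) : C :=
  iota (fun l : C_CompleteNormedModule => is_series a l).
Definition BCSeries (a : nat -> BC) : BC :=
  (CSeries (fun s => fst (a s)), CSeries (fun s => snd (a s))).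

Definition bessel_term (log : C -> C) (V Z : BC) (s : nat) : BC :=
  (BCofR ((-1) ^ s / INR (fact s)) * BCrgamma (V + BCofR (INR s) + BCofR 1)
   * BCpower log (BCofR (1 / 2) * Z) (V + BCofR (2 * INR s)))%BC.

Definition BCbessel (log : C -> C) (V Z : BC) : BC :=
  BCSeries (bessel_term log V Z).

Definition u_integrand (log : C -> C) (V delta : BC) (s : nat) (u : BC) : BC :=
  (BCpower log u (V - BCofR 1)
   * BCpower log (BCofR 1 - u) (delta + BCofR (INR s)))%BC.

Definition v_integrand (log : C -> C) (delta : BC) (s : nat) (v : BC) : BC :=
  (BCpower log v (delta - BCofR 1) * (v - BCofR 1) ^ s)%BC.

Definition expansion_term (log : C -> C) (V delta Z : BC) (s : nat) : BC :=
  (BCofR (/ (4 ^ s * INR (fact s) ^ 2)) * Z ^ (2 * s)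
   * (BCint01 (u_integrand log V delta s) * BCint01 (v_integrand log delta s)))%BC.

(* Main.v *)
(* In each idempotent component, with [Re nu > 0], the u-integral is
   [B(nu, delta+s+1)] and the v-integral is [(-1)^s B(delta, s+1)], so that
   [B(a,b) = Gamma(a) Gamma(b) / Gamma(a+b)] turns the right-hand series into the
   Bessel series term by term.  The v-integral at [s = 0] is that of
   [v^(delta-1)]; its convergence forces [Re delta > 0], because the integral from
   [a] to [c a] is [a^delta] times a constant that is nonzero for suitable [c].
   Integration by parts gives [B(a,b) (b)_n = (a+b)_n B(a,b+n)] and
   [B(a,n+1) (a)_{n+1} = n!], so with Gauss's product for [1 / Gamma] the beta
   identity reduces to [B(a,b+n+1) / B(a,n+1) -> 1].  For [Re b >= 1] this follows
   from [|1 - (1-t)^b| <= |b| t] and the boundedness of [|(a)_n| / (Re a)_n]. *)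

Require Import Defs.
From Stdlib Require Import Reals Lra Lia Factorial FunctionalExtensionality.
From Coquelicot Require Import Coquelicot.

Local Open Scope R_scope.

(** * Complex exponentials and the beta kernel *)

(** Every integral that occurs is some [B(a,b)] with [Re b >= 1], since [b] is [delta+s+1] or [s+1].
    Hence [|(1-t)^(b-1)| <= 1], only the end point 0 is singular, and [|B(a,b)| <= 1 / Re a]
    uniformly in [b], which also makes the expansion series converge. The condition on [beta1] and
    [beta2] gives only [Re > -1] for the components of [delta], short of what [v^(delta-1)]
    requires; positivity is therefore read off from convergence. [Crgamma] is the [iota] of a limit,
    so the existence of Gauss's limit has to be proved: consecutive terms have quotient
    [1 + O(1/n^2)]. In the beta identity [B(a,b+n+1)] and [B(a,n+1)] both tend to 0, so their
    difference must be small relative to [n! / (a)_{n+1}]. It is at most [|b| B(Re a + 1, n+1)], an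
    integral with real parameters and an explicit value; the bounded quotient [|(a)_n| / (Re a)_n]
    carries the estimate back to complex [a], with relative error [O(1/n)]. *)

Lemma Cexp_plus (z w : C) : Cexp (z + w) = (Cexp z * Cexp w)%C.
Proof.
destruct z as [a b], w as [c d]; unfold Cexp; simpl.
rewrite exp_plus, cos_plus, sin_plus.
apply injective_projections; simpl; ring.
Qed.

Lemma Cexp_0 : Cexp (RtoC 0) = RtoC 1.
Proof.
unfold Cexp; simpl; rewrite exp_0, cos_0, sin_0.
apply injective_projections; simpl; ring.
Qed.

Lemma Cexp_R (x : R) : Cexp (RtoC x) = RtoC (exp x).
Proof.
unfold Cexp; simpl; rewrite cos_0, sin_0.
apply injective_projections; simpl; ring.
Qed.

Lemma Cmod_Cexp (z : C) : Cmod (Cexp z) = exp (Re z).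
Proof.
destruct z as [a b]; unfold Cmod, Cexp; simpl.
transitivity (sqrt (Rsqr (exp a))); [ | apply sqrt_Rsqr; left; apply exp_pos].
f_equal; unfold Rsqr; generalize (sin2_cos2 b); unfold Rsqr; intros H.
transitivity (exp a * exp a * (sin b * sin b + cos b * cos b)); [ring | rewrite H; ring].
Qed.

(* [prod_norm] takes absolute values before squaring, so this is not a conversion. *)
Lemma norm_C_R (z : C) : norm (z : C_R_NormedModule) = Cmod z.
Proof.
destruct z as [a b]; unfold Cmod; unfold norm; simpl.
unfold prod_norm, norm; simpl; unfold abs; simpl.
now rewrite !Rmult_1_r, <- !Rabs_mult, !Rabs_pos_eq by (apply Rle_0_sqr).
Qed.

(** Splits a complex derivative into two real ones, which [auto_derive] can compute; the function is
    rebuilt as a real combination of the basis vectors 1 and i. *)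
Lemma is_derive_C (f g : R -> R) (t f' g' : R) :
  is_derive f t f' -> is_derive g t g' ->
  is_derive (V := C_R_NormedModule) (fun x => (f x, g x) : C) t (f', g').
Proof.
intros Hf Hg.
apply is_derive_ext with
  (fun x => plus (scal (f x) ((1, 0) : C_R_NormedModule))
              (scal (g x) ((0, 1) : C_R_NormedModule))).
- intros x; apply injective_projections; simpl; unfold plus, scal; simpl;
    unfold mult; simpl; ring.
- replace ((f', g') : C_R_NormedModule) with
    (plus (scal f' ((1, 0) : C_R_NormedModule))
       (scal g' ((0, 1) : C_R_NormedModule))).
  + apply (@is_derive_plus R_AbsRing C_R_NormedModule);
      apply (@is_derive_scal_l R_AbsRing C_R_NormedModule); assumption.
  + apply injective_projections; simpl; unfold plus, scal; simpl;
      unfold mult; simpl; ring.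
Qed.

(** The function [t^a (1-t)^b] on (0,1). As a single exponential of real logarithms it does not
    depend on the branch, and exponents simply add. Euler's integrand for [B(a,b)] is the kernel at
    [a - 1], [b - 1]. *)
Definition beta_kernel (a b : C) (t : R) : C :=
  Cexp (a * RtoC (ln t) + b * RtoC (ln (1 - t))).

Lemma beta_kernel_plus (a b c d : C) (t : R) :
  beta_kernel (a + c) (b + d) t = (beta_kernel a b t * beta_kernel c d t)%C.
Proof.
unfold beta_kernel; rewrite <- Cexp_plus; f_equal; ring.
Qed.

Lemma beta_kernel_1_0 (t : R) : 0 < t -> beta_kernel 1 0 t = RtoC t.
Proof.
intros Ht; unfold beta_kernel.
replace (1 * RtoC (ln t) + 0 * RtoC (ln (1 - t)))%C with (RtoC (ln t)) by ring.
now rewrite Cexp_R, exp_ln.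
Qed.

Lemma beta_kernel_0_1 (t : R) : t < 1 -> beta_kernel 0 1 t = RtoC (1 - t).
Proof.
intros Ht; unfold beta_kernel.
replace (0 * RtoC (ln t) + 1 * RtoC (ln (1 - t)))%C with (RtoC (ln (1 - t))) by ring.
now rewrite Cexp_R, exp_ln by lra.
Qed.

Lemma beta_kernel_Sl (a b : C) (t : R) :
  0 < t -> beta_kernel (a + 1) b t = (beta_kernel a b t * RtoC t)%C.
Proof.
intros Ht; rewrite <- (beta_kernel_1_0 t) by assumption.
rewrite <- beta_kernel_plus; f_equal; ring.
Qed.

Lemma beta_kernel_Sr (a b : C) (t : R) :
  t < 1 -> beta_kernel a (b + 1) t = (beta_kernel a b t * RtoC (1 - t))%C.
Proof.
intros Ht; rewrite <- (beta_kernel_0_1 t) by assumption.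
rewrite <- beta_kernel_plus; f_equal; ring.
Qed.

Lemma RtoC_nz (x : R) : x <> 0 -> RtoC x <> RtoC 0.
Proof. intros H H1; apply H; injection H1; auto. Qed.

Lemma is_derive_beta_kernel (a b : C) (t : R) : 0 < t < 1 ->
  is_derive (V := C_R_NormedModule) (beta_kernel a b) t
    (a * beta_kernel (a - 1) b t - b * beta_kernel a (b - 1) t)%C.
Proof.
intros Ht.
(* Dividing by [t] and by [1 - t] expresses the kernels with lowered exponents through the original
   one, so that [field] can finish once its exponential, cosine and sine are abstracted. *)
assert (Ha : beta_kernel (a - 1) b t = (beta_kernel a b t / RtoC t)%C).
{ replace (beta_kernel a b t) with (beta_kernel (a - 1 + 1) b t) by (f_equal; ring).
  rewrite beta_kernel_Sl by lra; field; apply RtoC_nz; lra. }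
assert (Hb : beta_kernel a (b - 1) t = (beta_kernel a b t / RtoC (1 - t))%C).
{ replace (beta_kernel a b t) with (beta_kernel a (b - 1 + 1) t) by (f_equal; ring).
  rewrite beta_kernel_Sr by lra; field; apply RtoC_nz; lra. }
rewrite Ha, Hb; clear Ha Hb.
destruct a as [a1 a2], b as [b1 b2].
apply is_derive_ext with (fun t =>
  (exp (a1 * ln t + b1 * ln (1 - t)) * cos (a2 * ln t + b2 * ln (1 - t)),
   exp (a1 * ln t + b1 * ln (1 - t)) * sin (a2 * ln t + b2 * ln (1 - t))) : C).
{ intros x; unfold beta_kernel, Cexp; simpl.
  apply injective_projections; simpl; f_equal; f_equal; ring. }
match goal with |- is_derive _ _ ?l => rewrite (surjective_pairing l) end.
apply is_derive_C; auto_derive; try (repeat split; lra);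
  unfold beta_kernel, Cexp; simpl;
  replace (1 + - t) with (1 - t) by ring;
  replace (a1 * ln t - a2 * 0 + (b1 * ln (1 - t) - b2 * 0))
    with (a1 * ln t + b1 * ln (1 - t)) by ring;
  replace (a1 * 0 + a2 * ln t + (b1 * 0 + b2 * ln (1 - t)))
    with (a2 * ln t + b2 * ln (1 - t)) by ring;
  generalize (exp (a1 * ln t + b1 * ln (1 - t)))
    (cos (a2 * ln t + b2 * ln (1 - t))) (sin (a2 * ln t + b2 * ln (1 - t)));
  intros; field; repeat split; nra.
Qed.

Lemma continuous_beta_kernel (a b : C) (t : R) : 0 < t < 1 ->
  continuous (beta_kernel a b : R -> C_R_NormedModule) t.
Proof.
intros Ht; apply (@ex_derive_continuous R_AbsRing C_R_NormedModule).
eexists; now apply is_derive_beta_kernel.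
Qed.

Lemma Cmod_beta_kernel (a b : C) (t : R) :
  Cmod (beta_kernel a b t) = exp (Re a * ln t + Re b * ln (1 - t)).
Proof.
unfold beta_kernel; rewrite Cmod_Cexp; f_equal.
destruct a, b; simpl; ring.
Qed.

Lemma ln_le_0 (t : R) : 0 < t < 1 -> ln t < 0.
Proof. intros H; rewrite <- ln_1; apply ln_increasing; lra. Qed.

Lemma exp_le_exp (x y : R) : x <= y -> exp x <= exp y.
Proof.
intros [H | ->]; [left; now apply exp_increasing | apply Rle_refl].
Qed.

Lemma Cmod_beta_kernel_le_l (a b : C) (t : R) : 0 < t < 1 -> 0 <= Re b ->
  Cmod (beta_kernel a b t) <= exp (Re a * ln t).
Proof.
intros Ht Hb; rewrite Cmod_beta_kernel; apply exp_le_exp.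
assert (ln (1 - t) < 0) by (apply ln_le_0; lra); nra.
Qed.

Lemma Cmod_beta_kernel_le_r (a b : C) (t : R) : 0 < t < 1 -> 0 <= Re a ->
  Cmod (beta_kernel a b t) <= exp (Re b * ln (1 - t)).
Proof.
intros Ht Hb; rewrite Cmod_beta_kernel; apply exp_le_exp.
assert (ln t < 0) by (apply ln_le_0; lra); nra.
Qed.

Lemma exp_ln_small (al eps : R) : 0 < al -> 0 < eps ->
  exists d : posreal, forall t, 0 < t < d -> exp (al * ln t) < eps.
Proof.
(* The radius is [eps^(1/al)]. *)
intros Ha He; exists (mkposreal _ (exp_pos (ln eps / al))); simpl; intros t Ht.
rewrite <- (exp_ln eps) at 1 by assumption; apply exp_increasing.
assert (ln t < ln eps / al).
{ rewrite <- (ln_exp (ln eps / al)); now apply ln_increasing. }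
apply Rmult_lt_compat_l with (r := al) in H; trivial.
now replace (al * (ln eps / al)) with (ln eps) in H by (field; lra).
Qed.

Lemma at_right_0_intro (P : R -> Prop) (d : posreal) :
  (forall t, 0 < t < d -> P t) -> at_right 0 P.
Proof.
intros H; exists d; intros t Hb Ht; apply H.
unfold ball in Hb; simpl in Hb; unfold AbsRing_ball, abs, minus, plus, opp in Hb;
  simpl in Hb; rewrite Rabs_pos_eq in Hb; lra.
Qed.

Lemma at_left_1_intro (P : R -> Prop) (d : posreal) :
  (forall t, 0 < 1 - t < d -> P t) -> at_left 1 P.
Proof.
intros H; exists d; intros t Hb Ht; apply H.
unfold ball in Hb; simpl in Hb; unfold AbsRing_ball, abs, minus, plus, opp in Hb;
  simpl in Hb; rewrite Rabs_left in Hb; lra.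
Qed.

Lemma at_right_0_Ioo : at_right 0 (fun t => 0 < t < 1).
Proof.
apply at_right_0_intro with (mkposreal 1 Rlt_0_1); simpl; intros; lra.
Qed.

Lemma at_left_1_Ioo : at_left 1 (fun t => 0 < t < 1).
Proof.
apply at_left_1_intro with (mkposreal 1 Rlt_0_1); simpl; intros; lra.
Qed.

Lemma beta_kernel_lim_0 (a b : C) : 0 < Re a -> 0 <= Re b ->
  filterlim (beta_kernel a b) (at_right 0)
    (locally (zero : C_R_NormedModule)).
Proof.
intros Ha Hb; apply filterlim_locally; intros eps.
destruct (exp_ln_small (Re a) eps Ha (cond_pos eps)) as [d Hd].
generalize (filter_and _ _ at_right_0_Ioo
  (at_right_0_intro (fun t => 0 < t < d) d (fun t H => H))).
apply filter_imp; intros t [Ht Htd].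
apply (norm_compat1 (V := C_R_NormedModule)).
rewrite (minus_zero_r (G := C_R_NormedModule)), norm_C_R.
apply Rle_lt_trans with (2 := Hd t Htd).
now apply (Cmod_beta_kernel_le_l a b).
Qed.

Lemma beta_kernel_lim_1 (a b : C) : 0 <= Re a -> 0 < Re b ->
  filterlim (beta_kernel a b) (at_left 1)
    (locally (zero : C_R_NormedModule)).
Proof.
intros Ha Hb; apply filterlim_locally; intros eps.
destruct (exp_ln_small (Re b) eps Hb (cond_pos eps)) as [d Hd].
generalize (filter_and _ _ at_left_1_Ioo
  (at_left_1_intro (fun t => 0 < 1 - t < d) d (fun t H => H))).
apply filter_imp; intros t [Ht Htd].
apply (norm_compat1 (V := C_R_NormedModule)).
rewrite (minus_zero_r (G := C_R_NormedModule)), norm_C_R.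
apply Rle_lt_trans with (2 := Hd (1 - t) Htd).
now apply (Cmod_beta_kernel_le_r a b).
Qed.

(** Separating the two end points at 1/2 also orders them, which the norm estimates for integrals
    require. *)
Lemma filter_prod_Ioo :
  filter_prod (at_right 0) (at_left 1)
    (fun ab : R * R => (0 < fst ab < 1 /\ 0 < snd ab < 1) /\ fst ab <= snd ab).
Proof.
apply Filter_prod with (fun t => 0 < t < 1 / 2) (fun t => 1 / 2 < t < 1).
- apply at_right_0_intro with (mkposreal (1 / 2) ltac:(lra)); simpl; intros; lra.
- apply at_left_1_intro with (mkposreal (1 / 2) ltac:(lra)); simpl; intros; lra.
- simpl; intros; lra.
Qed.

Definition is_int01 (f : R -> C) (l : C) : Prop :=
  is_RInt_gen (V := C_R_CompleteNormedModule) f (at_right 0) (at_left 1) l.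

(** [is_RInt_gen] is a limit along a relation between end points and values; once a function [F] of
    the end points supplies the values, an ordinary limit is enough. *)
Lemma is_int01_of_RInt (f : R -> C) (F : R -> R -> C) (l : C) :
  (forall a b, 0 < a < 1 -> 0 < b < 1 ->
     is_RInt (V := C_R_CompleteNormedModule) f a b (F a b)) ->
  filterlim (fun ab : R * R => F (fst ab) (snd ab))
    (filter_prod (at_right 0) (at_left 1))
    (locally (l : C_R_CompleteNormedModule)) ->
  is_int01 f l.
Proof.
intros HF Hl P HP; specialize (Hl P HP); unfold filtermap in Hl.
unfold filtermapi; generalize (filter_and _ _ filter_prod_Ioo Hl).
apply filter_imp; intros [a b] [[[Ha Hb] _] H]; simpl in *.
exists (F a b); split; auto.
Qed.

Lemma Ioo_between (a b t : R) : 0 < a < 1 -> 0 < b < 1 ->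
  Rmin a b <= t <= Rmax a b -> 0 < t < 1.
Proof.
intros Ha Hb; unfold Rmin, Rmax; destruct (Rle_dec a b); lra.
Qed.

(** The primitive enters only through its one-sided limits: since [ln 0 = 0], a kernel takes the
    default value 1 at both end points, whatever its limits there are. *)
Lemma is_int01_derive (H h : R -> C) (l0 l1 : C) :
  (forall t, 0 < t < 1 -> is_derive (V := C_R_NormedModule) H t (h t)) ->
  (forall t, 0 < t < 1 -> continuous (h : R -> C_R_NormedModule) t) ->
  filterlim H (at_right 0) (locally (l0 : C_R_NormedModule)) ->
  filterlim H (at_left 1) (locally (l1 : C_R_NormedModule)) ->
  is_int01 h (l1 - l0).
Proof.
intros Hd Hc H0 H1.
apply is_int01_of_RInt with (fun a b => (H b - H a)%C).
- intros a b Ha Hb.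
  apply (is_RInt_derive (V := C_R_CompleteNormedModule) H h); intros t Ht;
    [apply Hd | apply Hc]; now apply (Ioo_between a b).
- apply (filterlim_comp_2 (H := locally (opp l0 : C_R_NormedModule))
    (G := locally (l1 : C_R_NormedModule))
    (fun ab : R * R => H (snd ab)) (fun ab => opp (H (fst ab) : C_R_NormedModule))
    (fun x y => plus x y : C_R_NormedModule)).
  + apply filterlim_comp with (2 := H1); apply filterlim_snd.
  + apply filterlim_comp with (f := fun ab : R * R => H (fst ab))
      (2 := filterlim_opp (l0 : C_R_NormedModule)).
    apply filterlim_comp with (2 := H0); apply filterlim_fst.
  + apply (filterlim_plus (l1 : C_R_NormedModule) (opp l0)).
Qed.

Lemma norm_is_RInt_le_derive (f : R -> C) (g G : R -> R) (a b : R) (l : C) :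
  a <= b ->
  (forall t, a <= t <= b -> is_derive G t (g t)) ->
  (forall t, a <= t <= b -> continuous g t) ->
  (forall t, a <= t <= b -> Cmod (f t) <= g t) ->
  is_RInt (V := C_R_CompleteNormedModule) f a b l ->
  Cmod l <= G b - G a.
Proof.
intros Hab HG Hg Hf Hl.
rewrite <- norm_C_R; apply (norm_RInt_le (V := C_R_CompleteNormedModule) f g a b l); trivial.
{ intros t Ht; rewrite norm_C_R; auto. }
apply (is_RInt_derive G g); rewrite Rmin_left, Rmax_right by assumption; trivial.
Qed.

(** * Improper integrals over (0, 1) and the beta function *)

Lemma is_int01_unique (f : R -> C) (l : C) : is_int01 f l -> Cint01 f = l.
Proof.
exact (is_RInt_gen_unique (V := C_R_CompleteNormedModule) (Fa := at_right 0)
  (Fb := at_left 1) f l).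
Qed.

Lemma is_int01_ext (f g : R -> C) (l : C) :
  (forall t, 0 < t < 1 -> f t = g t) -> is_int01 f l -> is_int01 g l.
Proof.
intros Hfg; unfold is_int01; apply (is_RInt_gen_ext (V := C_R_CompleteNormedModule) (Fa := at_right 0)
  (Fb := at_left 1) f g l).
generalize filter_prod_Ioo; apply filter_imp; intros [a b] [[Ha Hb] _] t Ht.
apply Hfg; apply (Ioo_between a b); simpl in *; lra.
Qed.

Lemma is_int01_minus (f g : R -> C) (lf lg : C) :
  is_int01 f lf -> is_int01 g lg ->
  is_int01 (fun t => f t - g t)%C (lf - lg)%C.
Proof. exact (is_RInt_gen_minus (V := C_R_CompleteNormedModule) (Fa := at_right 0)
  (Fb := at_left 1) f g lf lg). Qed.

(** The scalars of [C_R_NormedModule] are real, so a complex constant has to pass through real and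
    imaginary parts. *)
Lemma is_RInt_Cmult (c : C) (f : R -> C) (a b : R) (l : C) :
  is_RInt (V := C_R_NormedModule) f a b l ->
  is_RInt (V := C_R_NormedModule) (fun t => c * f t)%C a b (c * l)%C.
Proof.
intros H; destruct c as [c1 c2].
generalize (is_RInt_fct_extend_fst (U := R_NormedModule) (V := R_NormedModule) _ _ _ _ H)
  (is_RInt_fct_extend_snd (U := R_NormedModule) (V := R_NormedModule) _ _ _ _ H).
intros H1 H2.
apply (is_RInt_fct_extend_pair (U := R_NormedModule) (V := R_NormedModule)); simpl.
- apply (is_RInt_minus (V := R_NormedModule));
    now apply (is_RInt_scal (V := R_NormedModule)).
- apply (is_RInt_plus (V := R_NormedModule));
    now apply (is_RInt_scal (V := R_NormedModule)).
Qed.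

Lemma is_int01_Cmult (c : C) (f : R -> C) (l : C) :
  is_int01 f l -> is_int01 (fun t => c * f t)%C (c * l)%C.
Proof.
intros H P HP.
assert (HP' : locally (l : C_NormedModule) (fun z => P (c * z)%C)).
{ apply (filterlim_scal_r (V := C_NormedModule) c l P HP). }
generalize (H _ HP'); unfold filtermapi; apply filter_imp.
intros [a b] [y [Hy Hc]]; exists (c * y)%C; split; trivial.
now apply is_RInt_Cmult.
Qed.

Lemma is_int01_Re (f : R -> C) (l : C) : is_int01 f l ->
  is_RInt_gen (fun t => Re (f t)) (at_right 0) (at_left 1) (Re l).
Proof.
intros H P HP.
assert (HP' : locally (l : C_R_NormedModule) (fun z => P (Re z))).
{ destruct l as [l1 l2]; apply (continuous_fst l1 l2 P HP). }
generalize (H _ HP'); unfold filtermapi; apply filter_imp.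
intros [a b] [y [Hy Hc]]; exists (Re y); split; trivial.
apply (is_RInt_fct_extend_fst (U := R_NormedModule) (V := R_NormedModule) _ _ _ _ Hy).
Qed.

(** The majorant is complex-valued and compared through its real part, so that a multiple of a
    [beta_kernel] with real exponents can serve as [g]. *)
Lemma is_int01_norm_le (f g : R -> C) (lf lg : C) :
  (forall t, 0 < t < 1 -> Cmod (f t) <= Re (g t)) ->
  is_int01 f lf -> is_int01 g lg -> Cmod lf <= Re lg.
Proof.
intros Hfg Hf Hg; rewrite <- norm_C_R.
apply (RInt_gen_norm (V := C_R_CompleteNormedModule) (Fa := at_right 0)
  (Fb := at_left 1) f (fun t => Re (g t))); trivial.
- generalize filter_prod_Ioo; apply filter_imp; tauto.
- generalize filter_prod_Ioo; apply filter_imp; intros [a b] [[Ha Hb] Hab] t Ht.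
  rewrite norm_C_R; apply Hfg; simpl in *; lra.
- now apply is_int01_Re.
Qed.

(** The majorant has the explicit primitive [G t = K t^al / al], so every integral over a
    subinterval is bounded by an increment of [G]. As [G] tends to 0 at 0 and to [K / al] at 1, this
    yields both the Cauchy condition and the bound on the limit. *)
Lemma int01_dominated (f : R -> C) (K al : R) : 0 < al ->
  (forall t, 0 < t < 1 -> continuous (f : R -> C_R_NormedModule) t) ->
  (forall t, 0 < t < 1 -> Cmod (f t) <= K * exp ((al - 1) * ln t)) ->
  exists l, is_int01 f l /\ Cmod l <= K / al.
Proof.
intros Hal Hc Hb.
set (G := fun t => K / al * exp (al * ln t)).
set (F := fun a b => RInt (V := C_R_CompleteNormedModule) f a b).
assert (HK : 0 <= K).
{ generalize (Rle_trans _ _ _ (Cmod_ge_0 _) (Hb (1 / 2) ltac:(lra))).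
  generalize (exp_pos ((al - 1) * ln (1 / 2))); nra. }
assert (HKal : 0 <= K / al) by (apply Rdiv_le_0_compat; lra).
assert (HF : forall a b, 0 < a < 1 -> 0 < b < 1 ->
  is_RInt (V := C_R_CompleteNormedModule) f a b (F a b)).
{ intros a b Ha H'b; apply (RInt_correct (V := C_R_CompleteNormedModule)).
  apply (ex_RInt_continuous (V := C_R_CompleteNormedModule)); intros t Ht.
  apply Hc; now apply (Ioo_between a b). }
assert (HG : forall t, 0 < t -> is_derive G t (K * exp ((al - 1) * ln t))).
{ intros t Ht; unfold G; auto_derive; [assumption | ].
  replace ((al - 1) * ln t) with (al * ln t - ln t) by ring.
  unfold Rminus; rewrite exp_plus, exp_Ropp, exp_ln by assumption; field; lra. }
assert (HFG : forall a b, 0 < a < 1 -> 0 < b < 1 -> a <= b ->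
  Cmod (F a b) <= G b - G a).
{ intros a b Ha H'b Hab.
  apply norm_is_RInt_le_derive with f (fun t => K * exp ((al - 1) * ln t)); auto.
  - intros t Ht; apply HG; lra.
  - intros t Ht; apply (ex_derive_continuous (V := R_NormedModule)).
    auto_derive; lra.
  - intros t Ht; apply Hb; lra. }
(* The Cauchy condition compares [a'] with [a] and [b] with [b'] in unknown order, hence the
   absolute value. *)
assert (HFG' : forall a b, 0 < a < 1 -> 0 < b < 1 ->
  Cmod (F a b) <= Rabs (G b - G a)).
{ intros a b Ha H'b; destruct (Rle_dec a b) as [Hab | Hab].
  - apply Rle_trans with (2 := Rle_abs _); auto.
  - unfold F; rewrite <- (opp_RInt_swap (V := C_R_CompleteNormedModule)) by
      (eexists; now apply HF).
    rewrite <- norm_C_R, (norm_opp (V := C_R_NormedModule)), norm_C_R.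
    rewrite <- Rabs_Ropp; apply Rle_trans with (2 := Rle_abs _).
    replace (- (G b - G a)) with (G a - G b) by ring.
    apply HFG; lra. }
assert (HG0 : forall eps, 0 < eps -> exists d : posreal,
  forall t, 0 < t < d -> 0 <= G t <= eps).
(* The divisor is [K / al + 1] because [K] may be 0. *)
{ intros eps He; destruct (exp_ln_small al (eps / (K / al + 1)) Hal) as [d Hd].
  - apply Rdiv_lt_0_compat; lra.
  - exists d; intros t Ht; specialize (Hd t Ht); unfold G; split.
    + generalize (exp_pos (al * ln t)); nra.
    + replace eps with ((K / al + 1) * (eps / (K / al + 1))) by (field; split; lra).
      generalize (exp_pos (al * ln t)); intros; apply Rmult_le_compat; lra. }
assert (HG1 : forall eps, 0 < eps -> exists d : posreal,
  forall t, 0 < 1 - t < d -> Rabs (G t - K / al) < eps).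
{ intros eps He.
  assert (Hc1 : continuous G 1).
  { apply (ex_derive_continuous (V := R_NormedModule)); eexists; apply HG; lra. }
  destruct (proj1 (filterlim_locally (F := locally 1) G (G 1)) Hc1 (mkposreal eps He))
    as [d Hd].
  exists d; intros t Ht.
  assert (HGt : ball (G 1) eps (G t)).
  { apply Hd; unfold ball; simpl; unfold AbsRing_ball, abs, minus, plus, opp; simpl.
    rewrite Rabs_left; lra. }
  revert HGt; unfold ball; simpl; unfold AbsRing_ball, abs, minus, plus, opp; simpl.
  unfold G at 2; rewrite ln_1, Rmult_0_r, exp_0, Rmult_1_r; trivial. }
assert (Hle1 : forall t, 0 < t < 1 -> G t <= K / al).
{ intros t Ht; unfold G; rewrite <- (Rmult_1_r (K / al)) at 2.
  apply Rmult_le_compat_l; [assumption | ].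
  rewrite <- exp_0; apply exp_le_exp.
  generalize (ln_le_0 t Ht); nra. }
assert (Hlim : exists l : C_R_CompleteNormedModule,
  filterlim (fun ab : R * R => F (fst ab) (snd ab))
    (filter_prod (at_right 0) (at_left 1)) (locally l)).
{ apply (filterlim_locally_cauchy (U := C_R_CompleteNormedModule)
    (F := filter_prod (at_right 0) (at_left 1))
    (fun ab : R * R => F (fst ab) (snd ab))); intros [eps He].
  (* The increments of [G] near 0 and near 1 are then at most [eps / 5] and [2 * eps / 5], whose sum
     stays strictly below [eps]. *)
  destruct (HG0 (eps / 5) ltac:(lra)) as [d0 Hd0].
  destruct (HG1 (eps / 5) ltac:(lra)) as [d1 Hd1].
  exists (fun ab => ((0 < fst ab < 1 /\ 0 < snd ab < 1) /\ fst ab <= snd ab) /\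
    (0 < fst ab < d0 /\ 0 < 1 - snd ab < d1)); split.
  - apply filter_and; [apply filter_prod_Ioo | ].
    apply Filter_prod with (fun t => 0 < t < d0) (fun t => 0 < 1 - t < d1).
    + now apply at_right_0_intro with d0.
    + now apply at_left_1_intro with d1.
    + simpl; auto.
  - intros [a b] [a' b'] [[[Ha H'b] _] [Ha0 Hb1]] [[[Ha' H'b'] _] [Ha0' Hb1']].
    simpl in *.
    apply (norm_compat1 (V := C_R_NormedModule)).
    rewrite norm_C_R.
    assert (HC : F a' b' = (F a b + (F a' a + F b b'))%C).
    { assert (HC1 := is_RInt_Chasles (V := C_R_CompleteNormedModule) _ _ _ _ _ _
        (HF a' a Ha' Ha) (HF a b Ha H'b)).
      assert (HC2 := is_RInt_Chasles (V := C_R_CompleteNormedModule) _ _ _ _ _ _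
        HC1 (HF b b' H'b H'b')).
      etransitivity; [apply (is_RInt_unique (V := C_R_CompleteNormedModule) _ _ _ _ HC2) | ].
      change ((F a' a + F a b + F b b')%C = (F a b + (F a' a + F b b'))%C); ring. }
    replace (minus (F a' b' : C_R_NormedModule) (F a b)) with (F a' a + F b b')%C
      by (change ((F a' a + F b b')%C = (F a' b' - F a b)%C); rewrite HC; ring).
    apply Rle_lt_trans with (1 := Cmod_triangle _ _).
    apply Rle_lt_trans with (1 := Rplus_le_compat _ _ _ _
      (HFG' a' a Ha' Ha) (HFG' b b' H'b H'b')).
    assert (H1 := Hd0 a Ha0); assert (H2 := Hd0 a' Ha0').
    assert (H3 := Hd1 b Hb1); assert (H4 := Hd1 b' Hb1').
    apply Rabs_def2 in H3; apply Rabs_def2 in H4.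
    assert (Rabs (G a - G a') <= eps / 5) by (apply Rabs_le; lra).
    assert (Rabs (G b' - G b) <= 2 * eps / 5) by (apply Rabs_le; lra).
    lra. }
destruct Hlim as [l Hl]; exists l; split.
- now apply is_int01_of_RInt with F.
- apply le_epsilon; intros eps He.
  assert (Hn := proj1 (filterlim_locally_ball_norm (U := C_R_CompleteNormedModule) _ l) Hl
    (mkposreal eps He)).
  destruct (filter_ex (F := filter_prod (at_right 0) (at_left 1)) _
    (filter_and _ _ filter_prod_Ioo Hn)) as [[a b] [[[Ha H'b] Hab] H]].
  simpl in *; unfold ball_norm in H.
  rewrite norm_C_R in H; change (Cmod (F a b - l)%C < eps) in H.
  replace l with (F a b - (F a b - l))%C by ring.
  apply Rle_trans with (1 := Cmod_triangle _ _); rewrite Cmod_opp.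
  assert (H1 := HFG a b Ha H'b Hab); assert (H2 := Hle1 b H'b).
  assert (0 <= G a) by (unfold G; generalize (exp_pos (al * ln a)); nra).
  lra.
Qed.

Lemma is_int01_beta_kernel_ex (a b : C) : 0 < Re a -> 1 <= Re b ->
  exists l, is_int01 (beta_kernel (a - 1) (b - 1)) l /\ Cmod l <= 1 / Re a.
Proof.
intros Ha Hb; apply int01_dominated; trivial.
- intros t Ht; now apply continuous_beta_kernel.
- intros t Ht; rewrite Rmult_1_l.
  replace (Re a - 1) with (Re (a - 1)) by (destruct a; simpl; ring).
  apply Cmod_beta_kernel_le_l; trivial; destruct b; simpl in *; lra.
Qed.

Definition Cbeta (a b : C) : C := Cint01 (beta_kernel (a - 1) (b - 1)).

Lemma is_int01_Cbeta (a b : C) : 0 < Re a -> 1 <= Re b ->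
  is_int01 (beta_kernel (a - 1) (b - 1)) (Cbeta a b).
Proof.
intros Ha Hb; destruct (is_int01_beta_kernel_ex a b Ha Hb) as [l [Hl _]].
unfold Cbeta; now rewrite (is_int01_unique _ _ Hl).
Qed.

Lemma Cmod_Cbeta_le (a b : C) : 0 < Re a -> 1 <= Re b ->
  Cmod (Cbeta a b) <= 1 / Re a.
Proof.
intros Ha Hb; destruct (is_int01_beta_kernel_ex a b Ha Hb) as [l [Hl Hle]].
unfold Cbeta; now rewrite (is_int01_unique _ _ Hl).
Qed.

(** Since [(a+b)(1-t) - b = a(1-t) - b t], the difference of the two integrands is the derivative of
    [t^a (1-t)^b], which tends to 0 at both ends. *)
Lemma Cbeta_Sr (a b : C) : 0 < Re a -> 1 <= Re b ->
  (b * Cbeta a b = (a + b) * Cbeta a (b + 1))%C.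
Proof.
intros Ha Hb.
assert (H1 := is_int01_Cbeta a b Ha Hb).
assert (H2 := is_int01_Cbeta a (b + 1) Ha ltac:(destruct b; simpl in *; lra)).
assert (H3 := is_int01_minus _ _ _ _ (is_int01_Cmult (a + b) _ _ H2)
  (is_int01_Cmult b _ _ H1)).
assert (H4 : is_int01 (fun t => a * beta_kernel (a - 1) b t - b * beta_kernel a (b - 1) t)%C
  (0 - 0)).
{ apply is_int01_derive with (beta_kernel a b).
  - intros t Ht; now apply is_derive_beta_kernel.
  - intros t Ht.
    apply (continuous_minus (V := C_R_NormedModule)
      (fun t => (a * beta_kernel (a - 1) b t)%C : C_R_NormedModule)
      (fun t => (b * beta_kernel a (b - 1) t)%C));
    apply (filterlim_comp _ _ _ _ (fun z : C => _ * z)%C _ _ _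
       (continuous_beta_kernel _ _ t Ht)); apply (filterlim_scal_r (V := C_NormedModule)).
  - apply beta_kernel_lim_0; lra.
  - apply beta_kernel_lim_1; lra. }
assert (E : ((a + b) * Cbeta a (b + 1) - b * Cbeta a b = 0 - 0)%C).
{ rewrite <- (is_int01_unique _ _ H4); symmetry; apply is_int01_unique.
  apply is_int01_ext with (2 := H3); intros t Ht.
  replace (b + 1 - 1)%C with (b - 1 + 1)%C by ring.
  replace (beta_kernel (a - 1) b t) with (beta_kernel (a - 1) (b - 1 + 1) t)
    by (f_equal; ring).
  replace (beta_kernel a (b - 1) t) with (beta_kernel (a - 1 + 1) (b - 1) t)
    by (f_equal; ring).
  rewrite beta_kernel_Sr, beta_kernel_Sl, RtoC_minus by lra; ring. }
replace (b * Cbeta a b)%C with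
  ((a + b) * Cbeta a (b + 1) - ((a + b) * Cbeta a (b + 1) - b * Cbeta a b))%C by ring.
rewrite E; ring.
Qed.

Lemma Cbeta_1 (a : C) : 0 < Re a -> (a * Cbeta a 1 = 1)%C.
Proof.
intros Ha.
assert (H1 := is_int01_Cmult a _ _ (is_int01_Cbeta a 1 Ha ltac:(simpl; lra))).
assert (H2 : is_int01 (fun t => a * beta_kernel (a - 1) 0 t - 0 * beta_kernel a (0 - 1) t)%C
  (1 - 0)).
{ apply is_int01_derive with (beta_kernel a 0).
  - intros t Ht; now apply is_derive_beta_kernel.
  - intros t Ht.
    apply (continuous_minus (V := C_R_NormedModule)
      (fun t => (a * beta_kernel (a - 1) 0 t)%C : C_R_NormedModule)
      (fun t => (0 * beta_kernel a (0 - 1) t)%C));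
    apply (filterlim_comp _ _ _ _ (fun z : C => _ * z)%C _ _ _
       (continuous_beta_kernel _ _ t Ht)); apply (filterlim_scal_r (V := C_NormedModule)).
  - apply beta_kernel_lim_0; simpl; lra.
  (* With second exponent 0 the kernel no longer vanishes at 1; its limit there is 1, by continuity
     of [t^a]. *)
  - assert (Hc : continuous (fun t => Cexp (a * RtoC (ln t)) : C_R_NormedModule) 1).
    { destruct a as [a1 a2]; unfold Cexp; simpl.
      apply (@ex_derive_continuous R_AbsRing C_R_NormedModule).
      eexists; apply is_derive_C; auto_derive; try lra; reflexivity. }
    unfold continuous in Hc.
    rewrite ln_1, Cmult_0_r, Cexp_0 in Hc.
    apply filterlim_ext with (fun t => Cexp (a * RtoC (ln t))).
    { intros t; unfold beta_kernel; f_equal; ring. }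
    apply filterlim_filter_le_1 with (2 := Hc); apply filter_le_within. }
rewrite <- (is_int01_unique _ _ H1).
transitivity (1 - 0)%C; [ | ring].
apply is_int01_unique, is_int01_ext with (2 := H2).
intros t Ht; replace (1 - 1)%C with (RtoC 0) by ring; ring.
Qed.

Lemma Re_plus_INR (b : C) (n : nat) : Re (b + RtoC (INR n)) = Re b + INR n.
Proof. now destruct b. Qed.

Lemma RtoC_S (n : nat) : RtoC (INR (S n)) = (RtoC (INR n) + 1)%C.
Proof. now rewrite S_INR, RtoC_plus. Qed.

Lemma Cbeta_Crising (a b : C) (n : nat) : 0 < Re a -> 1 <= Re b ->
  (Cbeta a b * Crising b n = Crising (a + b) n * Cbeta a (b + RtoC (INR n)))%C.
Proof.
intros Ha Hb; induction n as [ | n IH]; simpl Crising.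
- simpl INR; rewrite Cplus_0_r; ring.
- assert (Hbn : 1 <= Re (b + RtoC (INR n))) by
    (rewrite Re_plus_INR; generalize (pos_INR n); lra).
  rewrite Cmult_assoc, IH, RtoC_S.
  assert (H := Cbeta_Sr a _ Ha Hbn).
  replace (b + (RtoC (INR n) + 1))%C with (b + RtoC (INR n) + 1)%C by ring.
  rewrite <- Cmult_assoc, (Cmult_comm _ (b + _)), H; ring.
Qed.

Lemma Cbeta_S_Crising (a : C) (n : nat) : 0 < Re a ->
  (Cbeta a (1 + RtoC (INR n)) * Crising a (S n) = RtoC (INR (fact n)))%C.
Proof.
intros Ha; induction n as [ | n IH].
- simpl; rewrite !Cplus_0_r, Cmult_1_l, Cmult_comm; now apply Cbeta_1.
- change (Crising a (S (S n))) with (Crising a (S n) * (a + RtoC (INR (S n))))%C.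
  assert (H := Cbeta_Sr a (1 + RtoC (INR n)) Ha ltac:(rewrite Re_plus_INR;
    simpl; generalize (pos_INR n); lra)).
  replace (1 + RtoC (INR (S n)))%C with (1 + RtoC (INR n) + 1)%C by (rewrite RtoC_S; ring).
  replace (a + RtoC (INR (S n)))%C with (a + (1 + RtoC (INR n)))%C by (rewrite RtoC_S; ring).
  rewrite fact_simpl, mult_INR, RtoC_mult, <- IH, RtoC_S.
  rewrite (Cmult_comm (Crising a (S n))), Cmult_assoc.
  rewrite (Cmult_comm (Cbeta a (1 + RtoC (INR n) + 1))), <- H; ring.
Qed.

(** * Gauss's product and Euler's first integral *)

(** Taken by real and imaginary parts, so that products and uniqueness of limits come from the real
    theory; [Clim_filterlim] links it to the filter limit inside [Crgamma]. *)
Definition Clim (u : nat -> C) (l : C) : Prop :=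
  is_lim_seq (fun n => Re (u n)) (Re l) /\ is_lim_seq (fun n => Im (u n)) (Im l).

Lemma Clim_filterlim (u : nat -> C) (l : C) :
  Clim u l <-> filterlim u eventually (locally (l : C_CompleteNormedModule)).
Proof.
destruct l as [l1 l2]; split.
- intros [H1 H2] P [eps HP].
  generalize (filter_and (F := eventually) _ _
    (proj1 (filterlim_locally (fun n => Re (u n)) _) H1 eps)
    (proj1 (filterlim_locally (fun n => Im (u n)) _) H2 eps)).
  unfold filtermap; apply filter_imp; intros n [Hn1 Hn2]; apply HP; split; assumption.
- intros H; split; intros P HP.
  + apply (H (fun z => P (Re z))).
    exact (continuous_fst (U := R_UniformSpace) (V := R_UniformSpace) l1 l2 P HP).
  + apply (H (fun z => P (Im z))).
    exact (continuous_snd (U := R_UniformSpace) (V := R_UniformSpace) l1 l2 P HP).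
Qed.

Lemma Clim_unique (u : nat -> C) (l m : C) : Clim u l -> Clim u m -> l = m.
Proof.
intros [H1 H2] [H3 H4].
apply is_lim_seq_unique in H1, H2, H3, H4.
rewrite H1 in H3; rewrite H2 in H4; injection H3; injection H4; intros.
now apply injective_projections.
Qed.

Lemma Clim_mult (u v : nat -> C) (l m : C) :
  Clim u l -> Clim v m -> Clim (fun n => u n * v n)%C (l * m)%C.
Proof.
intros [H1 H2] [H3 H4]; split; simpl.
- apply is_lim_seq_minus'; now apply is_lim_seq_mult'.
- apply is_lim_seq_plus'; now apply is_lim_seq_mult'.
Qed.

Lemma Clim_ext_loc (u v : nat -> C) (l : C) :
  eventually (fun n => u n = v n) -> Clim u l -> Clim v l.
Proof.
intros He [H1 H2]; split; [revert H1 | revert H2]; apply is_lim_seq_ext_loc;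
  revert He; apply filter_imp; intros n Hn; now rewrite Hn.
Qed.

Lemma Clim_const (l : C) : Clim (fun _ => l) l.
Proof. split; apply is_lim_seq_const. Qed.

Lemma Clim_le (u : nat -> C) (l : C) (v : nat -> R) :
  eventually (fun n => Cmod (u n - l) <= v n) -> is_lim_seq v 0 -> Clim u l.
Proof.
intros He Hv; apply Clim_filterlim, filterlim_locally; intros eps.
generalize (filter_and (F := eventually) _ _ He
  (proj1 (filterlim_locally v _) Hv eps)).
apply filter_imp; intros n [H1 H2].
apply (norm_compat1 (V := C_R_NormedModule)); rewrite norm_C_R.
apply Rle_lt_trans with (1 := H1).
revert H2; unfold ball; simpl; unfold AbsRing_ball, abs, minus, plus, opp; simpl.
intros H2; apply Rabs_def2 in H2; lra.
Qed.

Lemma one_le_INR (n : nat) : (1 <= n)%nat -> 1 <= INR n.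
Proof. intros H; apply (le_INR 1 n H). Qed.

Lemma inv_sq_le_telescope (n : nat) : (1 <= n)%nat ->
  / INR (S n) ^ 2 <= / INR n - / INR (S n).
Proof.
intros Hn; apply one_le_INR in Hn; rewrite S_INR.
replace (/ INR n - / (INR n + 1)) with (/ (INR n * (INR n + 1))) by (field; lra).
apply Rinv_le_contravar; nra.
Qed.

(* [x n * exp (K / n)] is nonincreasing. *)
Lemma bounded_of_ratio (x : nat -> R) (K : R) : 0 <= K ->
  (forall n, (1 <= n)%nat -> 0 <= x n) ->
  (forall n, (1 <= n)%nat -> x (S n) <= (1 + K / INR (S n) ^ 2) * x n) ->
  exists M, 0 <= M /\ forall n, (1 <= n)%nat -> x n <= M.
Proof.
intros HK H0 Hr; exists (x 1%nat * exp K).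
assert (H1 := H0 1%nat (le_n 1)).
assert (Hinv : forall n, (1 <= n)%nat -> x n * exp (K / INR n) <= x 1%nat * exp K).
{ intros n Hn; induction Hn as [ | n Hn IH].
  - simpl; unfold Rdiv; rewrite Rinv_1, Rmult_1_r; lra.
  - apply Rle_trans with (2 := IH).
    assert (HE : 1 + K / INR (S n) ^ 2 <= exp (K / INR n - K / INR (S n))).
    { apply Rle_trans with (1 := exp_ineq1_le _); apply exp_le_exp.
      replace (K / INR n - K / INR (S n)) with (K * (/ INR n - / INR (S n)))
        by (unfold Rdiv; ring).
      apply Rmult_le_compat_l; trivial; now apply inv_sq_le_telescope. }
    replace (K / INR n) with ((K / INR n - K / INR (S n)) + K / INR (S n)) by ring.
    rewrite exp_plus, <- Rmult_assoc.
    apply Rmult_le_compat_r; [left; apply exp_pos | ].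
    apply Rle_trans with (1 := Hr n Hn).
    rewrite Rmult_comm; apply Rmult_le_compat_l; auto. }
split.
- apply Rmult_le_pos; [assumption | left; apply exp_pos].
- intros n Hn; apply Rle_trans with (2 := Hinv n Hn).
  rewrite <- (Rmult_1_r (x n)) at 1; apply Rmult_le_compat_l; auto.
  rewrite <- exp_0; apply exp_le_exp, Rdiv_le_0_compat; trivial.
  apply one_le_INR in Hn; lra.
Qed.

(** The relative bound on increments first bounds the sequence by some [M]; the increments are then
    at most [K M / (n+1)^2], which telescopes to [K M (1/n - 1/(n+p))], and the sequence is
    Cauchy. *)
Lemma Clim_of_ratio (c : nat -> C) (K : R) : 0 <= K ->
  (forall n, (1 <= n)%nat ->
     Cmod (c (S n) - c n) <= K / INR (S n) ^ 2 * Cmod (c n)) ->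
  exists l, Clim c l.
Proof.
intros HK Hc.
destruct (bounded_of_ratio (fun n => Cmod (c n)) K HK) as [M [HM0 HM]].
{ intros; apply Cmod_ge_0. }
{ intros n Hn; replace (c (S n)) with ((c (S n) - c n) + c n)%C by ring.
  apply Rle_trans with (1 := Cmod_triangle _ _); specialize (Hc n Hn); lra. }
assert (HKM : 0 <= K * M) by now apply Rmult_le_pos.
assert (Hd : forall n p, (1 <= n)%nat ->
  Cmod (c (n + p)%nat - c n) <= K * M * (/ INR n - / INR (n + p))).
{ intros n p Hn; induction p as [ | p IH].
  - rewrite Nat.add_0_r; replace (c n - c n)%C with (RtoC 0) by ring.
    rewrite Cmod_0; lra.
  - rewrite Nat.add_succ_r.
    replace (c (S (n + p)) - c n)%C with
      ((c (S (n + p)) - c (n + p)%nat) + (c (n + p)%nat - c n))%C by ring.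
    apply Rle_trans with (1 := Cmod_triangle _ _).
    assert (Hnp : (1 <= n + p)%nat) by lia.
    assert (H1 := Hc _ Hnp); assert (H2 := HM _ Hnp).
    assert (H3 := inv_sq_le_telescope _ Hnp).
    assert (H4 : K / INR (S (n + p)) ^ 2 * Cmod (c (n + p)%nat)
      <= K * M * (/ INR (n + p) - / INR (S (n + p)))).
    { assert (0 < / INR (S (n + p)) ^ 2)
        by (apply Rinv_0_lt_compat, pow_lt, lt_0_INR; lia).
      unfold Rdiv; rewrite (Rmult_comm (K * _)), <- Rmult_assoc, (Rmult_comm _ K).
      rewrite Rmult_assoc.
      apply Rle_trans with (K * M * / INR (S (n + p)) ^ 2).
      - rewrite <- Rmult_assoc; apply Rmult_le_compat_r; [lra | ].
        now apply Rmult_le_compat_l.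
      - now apply Rmult_le_compat_l. }
    lra. }
assert (Hlim : exists l : C_CompleteNormedModule,
  filterlim c eventually (locally l)).
{ apply (filterlim_locally_cauchy (U := C_CompleteNormedModule)
    (F := eventually) c); intros eps.
  assert (Hinv : is_lim_seq (fun n => K * M * / INR n) 0).
  { replace (Finite 0) with (Rbar_mult (K * M) 0) by (simpl; f_equal; ring).
    apply is_lim_seq_scal_l.
    apply (is_lim_seq_inv INR p_infty is_lim_seq_INR); discriminate. }
  destruct (proj1 (filterlim_locally (F := eventually) _ _) Hinv eps) as [N HN].
  assert (HN' : forall n, (N <= n)%nat -> K * M * / INR n < eps).
  { intros n Hn; specialize (HN n Hn); revert HN; unfold ball; simpl.
    unfold AbsRing_ball, abs, minus, plus, opp; simpl; intros HN.
    apply Rabs_def2 in HN; lra. }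
  assert (Hclose : forall n m, (S N <= n)%nat -> (n <= m)%nat ->
    Cmod (c m - c n) < eps).
  { intros n m Hn Hm; replace m with (n + (m - n))%nat by lia.
    apply Rle_lt_trans with (1 := Hd n (m - n)%nat ltac:(lia)).
    apply Rle_lt_trans with (2 := HN' n ltac:(lia)).
    apply Rmult_le_compat_l; trivial.
    assert (0 < / INR (n + (m - n))) by (apply Rinv_0_lt_compat, lt_0_INR; lia).
    lra. }
  exists (fun n => (S N <= n)%nat); split; [now exists (S N) | ].
  intros n m Hn Hm.
  apply (norm_compat1 (V := C_R_NormedModule)); rewrite norm_C_R.
  change (Cmod (c m - c n) < eps).
  destruct (Nat.le_ge_cases n m) as [H | H].
  - now apply Hclose.
  - rewrite <- Cmod_opp; replace (- (c m - c n))%C with (c n - c m)%C by ring.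
    now apply Hclose. }
destruct Hlim as [l Hl]; exists l; now apply Clim_filterlim.
Qed.

Lemma is_derive_linear_power (b c : C) (t : R) : t < 1 ->
  is_derive (V := C_R_NormedModule)
    (fun x => (1 + c * RtoC x) * Cexp (b * RtoC (ln (1 - x))))%C t
    ((c - b - c * (1 + b) * RtoC t) * Cexp ((b - 1) * RtoC (ln (1 - t))))%C.
Proof.
intros Ht.
assert (E : Cexp ((b - 1) * RtoC (ln (1 - t)))
  = (RtoC (/ (1 - t)) * Cexp (b * RtoC (ln (1 - t))))%C).
{ replace ((b - 1) * RtoC (ln (1 - t)))%C
    with (RtoC (- ln (1 - t)) + b * RtoC (ln (1 - t)))%C by (rewrite RtoC_opp; ring).
  now rewrite Cexp_plus, Cexp_R, exp_Ropp, exp_ln by lra. }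
rewrite E; clear E.
destruct b as [b1 b2], c as [c1 c2].
apply is_derive_ext with (fun x =>
  ((1 + c1 * x) * (exp (b1 * ln (1 - x)) * cos (b2 * ln (1 - x)))
   - c2 * x * (exp (b1 * ln (1 - x)) * sin (b2 * ln (1 - x))),
   (1 + c1 * x) * (exp (b1 * ln (1 - x)) * sin (b2 * ln (1 - x)))
   + c2 * x * (exp (b1 * ln (1 - x)) * cos (b2 * ln (1 - x)))) : C).
{ intros x; unfold Cexp; simpl.
  replace (b1 * ln (1 - x) - b2 * 0) with (b1 * ln (1 - x)) by ring.
  replace (b1 * 0 + b2 * ln (1 - x)) with (b2 * ln (1 - x)) by ring.
  apply injective_projections; simpl; ring. }
match goal with |- is_derive _ _ ?l => rewrite (surjective_pairing l) end.
apply is_derive_C; auto_derive; try (repeat split; lra);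
  unfold Cexp; simpl;
  replace (1 + - t) with (1 - t) by ring;
  replace (b1 * ln (1 - t) - b2 * 0) with (b1 * ln (1 - t)) by ring;
  replace (b1 * 0 + b2 * ln (1 - t)) with (b2 * ln (1 - t)) by ring;
  generalize (exp (b1 * ln (1 - t))) (cos (b2 * ln (1 - t))) (sin (b2 * ln (1 - t)));
  intros; field; lra.
Qed.

(* Applied with [c = 0] to bound [(1-h)^b - 1], and with [c = b], where the linear
   term of the derivative is all that survives, to bound [(1+zh)(1-h)^z - 1] by
   [O(h^2)], which is the ratio of consecutive terms of Gauss's product. *)
Lemma linear_power_bound (b c : C) (g G : R -> R) (h : R) : 0 <= h < 1 ->
  (forall t, 0 <= t <= h -> is_derive G t (g t)) ->
  (forall t, 0 <= t <= h -> continuous g t) ->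
  (forall t, 0 <= t <= h ->
     Cmod ((c - b - c * (1 + b) * RtoC t) * Cexp ((b - 1) * RtoC (ln (1 - t)))) <= g t) ->
  Cmod ((1 + c * RtoC h) * Cexp (b * RtoC (ln (1 - h))) - 1) <= G h - G 0.
Proof.
intros Hh HG Hg Hb.
set (F := (fun x => (1 + c * RtoC x) * Cexp (b * RtoC (ln (1 - x))))%C).
replace (RtoC 1) with (F 0) at 2.
2:{ unfold F; rewrite Rminus_0_r, ln_1, !Cmult_0_r, Cexp_0; ring. }
apply norm_is_RInt_le_derive with
  (fun t => (c - b - c * (1 + b) * RtoC t) * Cexp ((b - 1) * RtoC (ln (1 - t))))%C g;
  trivial; [lra | ].
apply (is_RInt_derive (V := C_R_CompleteNormedModule) F);
  rewrite Rmin_left, Rmax_right by lra; intros t Ht.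
- apply is_derive_linear_power; lra.
- apply (@ex_derive_continuous R_AbsRing C_R_NormedModule).
  destruct b as [b1 b2], c as [c1 c2]; unfold Cexp, Cmult; simpl.
  eexists; apply is_derive_C; auto_derive; try lra; try reflexivity; repeat split; lra.
Qed.

(** The derivative [-b (1-t)^(b-1)] has modulus at most [|b|] because [Re b >= 1]. *)
Lemma power_bound (b : C) (h : R) : 0 <= h < 1 -> 1 <= Re b ->
  Cmod (Cexp (b * RtoC (ln (1 - h))) - 1) <= Cmod b * h.
Proof.
intros Hh Hb.
replace (Cexp (b * RtoC (ln (1 - h)))) with
  ((1 + 0 * RtoC h) * Cexp (b * RtoC (ln (1 - h))))%C by ring.
apply Rle_trans with (Cmod b * h - Cmod b * 0); [ | lra].
apply linear_power_bound with (g := fun _ => Cmod b) (G := fun t => Cmod b * t); trivial.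
- intros t _; auto_derive; trivial; ring.
- intros t _; apply continuous_const.
- intros t Ht; replace (0 - b - 0 * (1 + b) * RtoC t)%C with (- b)%C by ring.
  rewrite Cmod_mult, Cmod_opp, Cmod_Cexp.
  rewrite <- (Rmult_1_r (Cmod b)) at 2.
  apply Rmult_le_compat_l; [apply Cmod_ge_0 | ].
  apply Rle_trans with (exp 0); [apply exp_le_exp | rewrite exp_0; apply Rle_refl].
  replace (Re ((b - 1) * RtoC (ln (1 - t)))) with ((Re b - 1) * ln (1 - t))
    by (destruct b; simpl; ring).
  assert (ln (1 - t) <= 0).
  { destruct (Req_dec t 0) as [-> | Ht0].
    - rewrite Rminus_0_r, ln_1; lra.
    - left; apply ln_le_0; lra. }
  nra.
Qed.

Lemma gauss_ratio_bound (z : C) (h : R) : 0 <= h <= 1 / 2 -> 0 < Re z ->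
  Cmod ((1 + z * RtoC h) * Cexp (z * RtoC (ln (1 - h))) - 1)
  <= Cmod (z * (1 + z)) * h ^ 2.
Proof.
intros Hh Hz; set (K := Cmod (z * (1 + z))).
apply Rle_trans with (K * h ^ 2 - K * 0 ^ 2); [ | right; ring].
apply linear_power_bound with (g := fun t => 2 * K * t) (G := fun t => K * t ^ 2);
  [lra | | | ].
- intros t _; auto_derive; trivial; ring.
- intros t _; apply (ex_derive_continuous (V := R_NormedModule)); now auto_derive.
- intros t Ht.
  replace (z - z - z * (1 + z) * RtoC t)%C with (- (z * (1 + z)) * RtoC t)%C by ring.
  rewrite Cmod_mult, Cmod_mult, Cmod_opp, Cmod_R, Rabs_pos_eq by lra.
  rewrite Cmod_Cexp.
  replace (Re ((z - 1) * RtoC (ln (1 - t)))) with ((Re z - 1) * ln (1 - t))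
    by (destruct z; simpl; ring).
  assert (Hl : ln (1 - t) <= 0).
  { destruct (Req_dec t 0) as [-> | Ht0].
    - rewrite Rminus_0_r, ln_1; lra.
    - left; apply ln_le_0; lra. }
  (* As [Re z > 0], the modulus of [(1-t)^(z-1)] is at most [1 / (1-t)], hence at most 2 for
     [h <= 1/2]; this 2 makes the bound [2 K t], the derivative of [K t^2]. *)
  assert (He : exp ((Re z - 1) * ln (1 - t)) <= 2).
  { apply Rle_trans with (exp (- ln (1 - t))); [apply exp_le_exp; nra | ].
    rewrite exp_Ropp, exp_ln by lra.
    replace 2 with (/ / 2) by field; apply Rinv_le_contravar; lra. }
  fold K.
  assert (0 <= K * t) by (apply Rmult_le_pos; [apply Cmod_ge_0 | lra]).
  nra.
Qed.

(* At [n = 0] the factor [n^(-z)] is a junk value, since [ln 0 = 0]. *)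
Lemma Cgauss_S (z : C) (n : nat) : (1 <= n)%nat ->
  Cgauss z (S n) = (Cgauss z n *
    ((1 + z * RtoC (/ INR (S n))) * Cexp (z * RtoC (ln (1 - / INR (S n))))))%C.
Proof.
intros Hn; apply one_le_INR in Hn; unfold Cgauss.
change (Crising z (S (S n))) with (Crising z (S n) * (z + RtoC (INR (S n))))%C.
assert (HS : INR (S n) <> 0) by (rewrite S_INR; lra).
replace (1 - / INR (S n)) with (INR n / INR (S n)) by (rewrite S_INR; field; lra).
unfold Rdiv; rewrite ln_mult, ln_Rinv by
  (try apply Rinv_0_lt_compat; rewrite ?S_INR; lra).
replace (- z * RtoC (ln (INR (S n))))%C with
  (- z * RtoC (ln (INR n)) + z * RtoC (ln (INR n) + - ln (INR (S n))))%C
  by (rewrite RtoC_plus, RtoC_opp; ring).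
rewrite Cexp_plus, fact_simpl, mult_INR, RtoC_mult, RtoC_inv by assumption.
field; split; apply RtoC_nz; trivial; apply INR_fact_neq_0.
Qed.

(** An [iota] says nothing until a limit is exhibited. The ratio criterion supplies one, with
    [h = 1 / (n+1)], which is at most 1/2 from [n = 1] on. *)
Lemma Clim_Cgauss (z : C) : 0 < Re z -> Clim (Cgauss z) (Crgamma z).
Proof.
intros Hz.
destruct (Clim_of_ratio (Cgauss z) (Cmod (z * (1 + z)))) as [l Hl].
- apply Cmod_ge_0.
- intros n Hn; rewrite Cgauss_S by assumption.
  set (r := ((1 + _) * _)%C).
  replace (Cgauss z n * r - Cgauss z n)%C with ((r - 1) * Cgauss z n)%C by ring.
  rewrite Cmod_mult; apply Rmult_le_compat_r; [apply Cmod_ge_0 | ].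
  unfold Rdiv; rewrite <- pow_inv; apply gauss_ratio_bound; trivial.
  apply one_le_INR in Hn; rewrite S_INR.
  split; [left; apply Rinv_0_lt_compat; lra | ].
  replace (1 / 2) with (/ 2) by field; apply Rinv_le_contravar; lra.
- replace (Crgamma z) with l; trivial; symmetry.
  apply (iota_filterlim_locally (V := C_CompleteNormedModule) (F := eventually) (Cgauss z) l).
  now apply Clim_filterlim.
Qed.

Lemma Crising_S_l (z : C) (n : nat) : (Crising z (S n) = z * Crising (z + 1) n)%C.
Proof.
induction n as [ | n IH].
- simpl; rewrite Cplus_0_r; ring.
- change (Crising z (S (S n))) with (Crising z (S n) * (z + RtoC (INR (S n))))%C.
  rewrite IH, RtoC_S; simpl; ring.
Qed.

Lemma is_lim_seq_inv_INR (x : R) : is_lim_seq (fun n => x / INR n) 0.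
Proof.
replace (Finite 0) with (Rbar_mult x 0) by (simpl; f_equal; ring).
apply is_lim_seq_scal_l.
apply (is_lim_seq_inv INR p_infty is_lim_seq_INR); discriminate.
Qed.

Lemma Crgamma_S (z : C) : 0 < Re z -> (Crgamma z = z * Crgamma (z + 1))%C.
Proof.
intros Hz.
apply Clim_unique with (fun n => z * Cgauss (z + 1) n)%C.
2:{ apply Clim_mult; [apply Clim_const | ].
    apply Clim_Cgauss; destruct z; simpl in *; lra. }
(* In [z * Cgauss (z + 1) n] the product [z (z+1)_{n+1}] is [(z)_{n+1} (z+1+n)], and the power of
   [n] contributes one more [1/n]; the quotient by [Cgauss z n] is therefore [1 + (z+1)/n]. *)
apply Clim_ext_loc with (fun n => Cgauss z n * (1 + (z + 1) * RtoC (/ INR n)))%C.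
- exists 1%nat; intros n Hn; apply one_le_INR in Hn.
  unfold Cgauss; rewrite Crising_S_l.
  change (Crising (z + 1) (S n)) with (Crising (z + 1) n * (z + 1 + RtoC (INR n)))%C.
  replace (- (z + 1) * RtoC (ln (INR n)))%C with
    (- z * RtoC (ln (INR n)) + RtoC (- ln (INR n)))%C by (rewrite RtoC_opp; ring).
  rewrite Cexp_plus, Cexp_R, exp_Ropp, exp_ln, RtoC_inv by lra.
  field; split; apply RtoC_nz; [lra | apply INR_fact_neq_0].
- rewrite <- (Cmult_1_r (Crgamma z)); apply Clim_mult; [now apply Clim_Cgauss | ].
  apply Clim_le with (fun n => Cmod (z + 1) / INR n); [ | apply is_lim_seq_inv_INR].
  exists 1%nat; intros n Hn; apply one_le_INR in Hn.
  replace (1 + (z + 1) * RtoC (/ INR n) - 1)%C with ((z + 1) * RtoC (/ INR n))%C by ring.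
  rewrite Cmod_mult, Cmod_R, Rabs_pos_eq; [apply Rle_refl | ].
  left; apply Rinv_0_lt_compat; lra.
Qed.

Lemma Crgamma_Crising (z : C) (n : nat) : 0 < Re z ->
  (Crgamma z = Crising z n * Crgamma (z + RtoC (INR n)))%C.
Proof.
intros Hz; induction n as [ | n IH].
- simpl; rewrite Cplus_0_r; ring.
- simpl Crising; rewrite IH, Crgamma_S, RtoC_S.
  + rewrite Cplus_assoc; ring.
  + rewrite Re_plus_INR; generalize (pos_INR n); lra.
Qed.

(** With [a = x + i y], [|a+N|^2 = (x+N)^2 + y^2] gives [|a+N| / (x+N) <= 1 + y^2/N^2], so the
    quotients satisfy the hypothesis of [bounded_of_ratio] with [K = y^2]. *)
Lemma Cmod_Crising_ratio_bounded (a : C) : 0 < Re a ->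
  exists M, 0 <= M /\ forall n, (1 <= n)%nat ->
    Cmod (Crising a (S n)) <= M * Cmod (Crising (RtoC (Re a)) (S n)).
Proof.
intros Ha.
assert (Hp : forall n, 0 < Cmod (Crising (RtoC (Re a)) n)).
{ induction n as [ | n IH]; simpl.
  - rewrite Cmod_1; lra.
  - rewrite Cmod_mult, <- RtoC_plus, Cmod_R, Rabs_pos_eq;
      generalize (pos_INR n); try lra; intros.
    apply Rmult_lt_0_compat; lra. }
destruct (bounded_of_ratio (fun n => Cmod (Crising a (S n)) /
  Cmod (Crising (RtoC (Re a)) (S n))) (Im a ^ 2)) as [M [HM0 HM]].
- apply pow2_ge_0.
- intros n _; apply Rdiv_le_0_compat; [apply Cmod_ge_0 | apply Hp].
- intros n Hn.
  change (Crising a (S (S n))) with (Crising a (S n) * (a + RtoC (INR (S n))))%C.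
  change (Crising (RtoC (Re a)) (S (S n))) with
    (Crising (RtoC (Re a)) (S n) * (RtoC (Re a) + RtoC (INR (S n))))%C.
  set (N := INR (S n)).
  assert (HN : 1 <= N) by (unfold N; rewrite S_INR; apply one_le_INR in Hn; lra).
  rewrite !Cmod_mult, <- RtoC_plus, Cmod_R, (Rabs_pos_eq (Re a + N)) by lra.
  assert (Hb : Cmod (a + RtoC N) <= (1 + Im a ^ 2 / N ^ 2) * (Re a + N)).
  { destruct a as [x y]; simpl Re in *; simpl Im in *.
    set (q := y ^ 2 / N ^ 2).
    assert (Hq : y ^ 2 = q * N ^ 2) by (unfold q; field; lra).
    assert (0 <= q) by (apply Rdiv_le_0_compat; [apply pow2_ge_0 | apply pow_lt; lra]).
    unfold Cmod; rewrite <- (sqrt_Rsqr ((1 + q) * (x + N))) by nra.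
    apply sqrt_le_1_alt; unfold Rsqr; simpl fst; simpl snd.
    rewrite Rplus_0_r, Hq.
    assert (q * N ^ 2 <= q * (x + N) ^ 2) by (apply Rmult_le_compat_l; nra).
    assert (0 <= q * (x + N) ^ 2 * (1 + q)) by (apply Rmult_le_pos; [apply Rmult_le_pos; nra | nra]).
    nra. }
  replace (Cmod (Crising a (S n)) * Cmod (a + RtoC N) /
    (Cmod (Crising (RtoC (Re a)) (S n)) * (Re a + N))) with
    (Cmod (a + RtoC N) / (Re a + N) * (Cmod (Crising a (S n)) /
      Cmod (Crising (RtoC (Re a)) (S n)))).
  2:{ field; split; [lra | apply Rgt_not_eq, Hp]. }
  apply Rmult_le_compat_r.
  + apply Rdiv_le_0_compat; [apply Cmod_ge_0 | apply Hp].
  + apply Rmult_le_reg_r with (Re a + N); [lra | ].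
    unfold Rdiv at 1; rewrite Rmult_assoc, Rinv_l by lra; lra.
- exists M; split; trivial; intros n Hn.
  apply Rmult_le_reg_r with (/ Cmod (Crising (RtoC (Re a)) (S n))).
  + apply Rinv_0_lt_compat, Hp.
  + rewrite Rmult_assoc, Rinv_r, Rmult_1_r by (apply Rgt_not_eq, Hp); now apply HM.
Qed.

Lemma Crising_R_nz (x : R) (n : nat) : 0 < x -> Crising (RtoC x) n <> RtoC 0.
Proof.
intros Hx; induction n as [ | n IH]; simpl.
- apply C1_nz.
- apply Cmult_neq_0; trivial; rewrite <- RtoC_plus; apply RtoC_nz.
  generalize (pos_INR n); lra.
Qed.

Lemma beta_kernel_R (x y t : R) :
  beta_kernel (RtoC x) (RtoC y) t = RtoC (exp (x * ln t + y * ln (1 - t))).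
Proof.
unfold beta_kernel; now rewrite <- !RtoC_mult, <- RtoC_plus, Cexp_R.
Qed.

(** The difference of the integrands is [t^(a-1) (1-t)^n ((1-t)^b - 1)], and [power_bound] gains a
    factor [t]. This raises the first parameter to [Re a + 1], which is what makes the difference
    smaller than either integral by a factor of order [1/n]. *)
Lemma Cbeta_shift_diff (a b : C) (n : nat) : 0 < Re a -> 1 <= Re b ->
  Cmod (Cbeta a (b + (1 + RtoC (INR n))) - Cbeta a (1 + RtoC (INR n)))
  <= Cmod b * Cmod (Cbeta (RtoC (Re a) + 1) (1 + RtoC (INR n))).
Proof.
intros Ha Hb.
assert (Hn := pos_INR n).
assert (H1 := is_int01_minus _ _ _ _
  (is_int01_Cbeta a (b + (1 + RtoC (INR n))) Ha ltac:(destruct b; simpl in *; lra))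
  (is_int01_Cbeta a (1 + RtoC (INR n)) Ha ltac:(simpl; lra))).
assert (H2 := is_int01_Cmult (RtoC (Cmod b)) _ _
  (is_int01_Cbeta (RtoC (Re a) + 1) (1 + RtoC (INR n)) ltac:(simpl; lra) ltac:(simpl; lra))).
apply Rle_trans with (Re (RtoC (Cmod b) * Cbeta (RtoC (Re a) + 1) (1 + RtoC (INR n)))%C).
2:{ apply Rle_trans with (1 := Rle_abs _).
    apply Rle_trans with (1 := re_le_Cmod _).
    rewrite Cmod_mult, Cmod_R, Rabs_pos_eq by apply Cmod_ge_0; apply Rle_refl. }
apply is_int01_norm_le with (2 := H1) (3 := H2); intros t Ht; cbv beta.
replace (b + (1 + RtoC (INR n)) - 1)%C with (RtoC (INR n) + b)%C by ring.
replace (1 + RtoC (INR n) - 1)%C with (RtoC (INR n) + 0)%C by ring.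
replace (a - 1)%C with (a - 1 + 0)%C by ring.
rewrite beta_kernel_plus, (beta_kernel_plus (a - 1) _ 0 0).
replace (beta_kernel 0 0 t) with (RtoC 1) by
  (unfold beta_kernel; rewrite !Cmult_0_l, Cplus_0_l, Cexp_0; reflexivity).
replace (beta_kernel 0 b t) with (Cexp (b * RtoC (ln (1 - t)))) by
  (unfold beta_kernel; f_equal; ring).
set (k := beta_kernel (a - 1) (RtoC (INR n)) t).
set (e := Cexp (b * _)).
replace (k * e - k * 1)%C with (k * (e - 1))%C by ring.
replace (RtoC (Re a) + 1 - 1)%C with (RtoC (Re a - 1) + 1)%C by (rewrite RtoC_minus; ring).
rewrite Cplus_0_r.
rewrite beta_kernel_Sl, beta_kernel_R, Cmod_mult by lra.
unfold k; rewrite Cmod_beta_kernel.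
replace (Re (a - 1)) with (Re a - 1) by (destruct a; simpl; ring).
rewrite re_RtoC; set (E := exp _).
apply Rle_trans with (E * (Cmod b * t)).
- apply Rmult_le_compat_l; [left; apply exp_pos | ].
  apply power_bound; lra.
- simpl; lra.
Qed.

Lemma Clim_Cbeta_shift (a b : C) : 0 < Re a -> 1 <= Re b ->
  Clim (fun n => Cbeta a (b + RtoC (INR (S n))) * Crising a (S n) / RtoC (INR (fact n)))%C 1.
Proof.
intros Ha Hb.
destruct (Cmod_Crising_ratio_bounded a Ha) as [M [HM0 HM]].
apply Clim_le with (fun n => Cmod b * M * Re a / INR n).
2:{ apply is_lim_seq_inv_INR. }
exists 1%nat; intros n Hn.
assert (Hn1 := one_le_INR n Hn).
assert (Hf : RtoC (INR (fact n)) <> RtoC 0) by (apply RtoC_nz, INR_fact_neq_0).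
replace (RtoC 1) with (Cbeta a (1 + RtoC (INR n)) * Crising a (S n) / RtoC (INR (fact n)))%C
  by (rewrite Cbeta_S_Crising by assumption; field; assumption).
replace (b + RtoC (INR (S n)))%C with (b + (1 + RtoC (INR n)))%C by (rewrite RtoC_S; ring).
set (D := Crising a (S n)).
replace (Cbeta a (b + (1 + RtoC (INR n))) * D / RtoC (INR (fact n))
  - Cbeta a (1 + RtoC (INR n)) * D / RtoC (INR (fact n)))%C with
  ((Cbeta a (b + (1 + RtoC (INR n))) - Cbeta a (1 + RtoC (INR n))) * (D / RtoC (INR (fact n))))%C
  by (field; assumption).
rewrite Cmod_mult.
apply Rle_trans with (1 := Rmult_le_compat_r _ _ _ (Cmod_ge_0 _) (Cbeta_shift_diff a b n Ha Hb)).
set (x := Re a) in *.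
assert (HB := Cbeta_S_Crising (RtoC x + 1) n ltac:(simpl; lra)).
assert (HR : (RtoC x * Crising (RtoC x + 1) (S n)
  = Crising (RtoC x) (S n) * (RtoC x + RtoC (INR (S n))))%C)
  by (rewrite <- Crising_S_l; reflexivity).
assert (Hnz1 := Crising_R_nz (x + 1) (S n) ltac:(lra)).
rewrite RtoC_plus in Hnz1.
assert (Hnz2 := Crising_R_nz x (S n) Ha).
assert (Hxn : (RtoC x + RtoC (INR (S n)))%C <> RtoC 0).
{ rewrite <- RtoC_plus; apply RtoC_nz; generalize (pos_INR (S n)); lra. }
(* Exact form of the error: [B(x+1,n+1) = n! / (x+1)_{n+1}] and [x (x+1)_{n+1} = (x)_{n+1} (x+n+1)].
   What remains is a bounded quotient times [x / (x+n+1)]. *)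
assert (E : (Cbeta (RtoC x + 1) (1 + RtoC (INR n)) * (D / RtoC (INR (fact n)))
  = D / Crising (RtoC x) (S n) * (RtoC x / (RtoC x + RtoC (INR (S n)))))%C).
{ rewrite <- HB.
  assert (HBnz : Cbeta (RtoC x + 1) (1 + RtoC (INR n)) <> RtoC 0).
  { intros H; rewrite H, Cmult_0_l in HB; now apply Hf. }
  transitivity (D * RtoC x / (RtoC x * Crising (RtoC x + 1) (S n)))%C.
  - field; repeat split; trivial; apply RtoC_nz; lra.
  - rewrite HR; field; split; trivial. }
rewrite Rmult_assoc, <- Cmod_mult, E, Cmod_mult.
unfold Rdiv; rewrite !Rmult_assoc; apply Rmult_le_compat_l; [apply Cmod_ge_0 | ].
apply Rmult_le_compat; try apply Cmod_ge_0.
- rewrite Cmod_div by assumption.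
  apply Rmult_le_reg_r with (Cmod (Crising (RtoC x) (S n))); [now apply Cmod_gt_0 | ].
  unfold Rdiv; rewrite Rmult_assoc, Rinv_l, Rmult_1_r.
  + now apply HM.
  + intros H; apply Hnz2; now apply Cmod_eq_0.
- rewrite <- RtoC_plus, <- RtoC_div, Cmod_R, Rabs_pos_eq.
  + apply Rmult_le_compat_l; [lra | ].
    apply Rinv_le_contravar; rewrite ?S_INR; lra.
  + apply Rdiv_le_0_compat; rewrite ?S_INR; lra.
  + rewrite S_INR; lra.
Qed.

(** Moving [(b)_{n+1}] into the beta factor turns [B(a,b)] times the Gauss products of [a] and [b]
    into the Gauss product of [a+b] times [B(a,b+n+1) (a)_{n+1} / n!], which tends to 1. *)
Lemma Cbeta_Crgamma (a b : C) : 0 < Re a -> 1 <= Re b ->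
  (Cbeta a b * (Crgamma a * Crgamma b) = Crgamma (a + b))%C.
Proof.
intros Ha Hb.
apply Clim_unique with (fun n => Cbeta a b * (Cgauss a n * Cgauss b n))%C.
- apply Clim_mult; [apply Clim_const | ].
  apply Clim_mult; apply Clim_Cgauss; lra.
- rewrite <- (Cmult_1_l (Crgamma (a + b))).
  assert (Hab : 0 < Re (a + b)) by (destruct a, b; simpl in *; lra).
  generalize (Clim_mult _ _ _ _ (Clim_Cbeta_shift a b Ha Hb) (Clim_Cgauss _ Hab)).
  apply Clim_ext_loc; exists 0%nat; intros n _; unfold Cgauss.
  replace (- (a + b) * RtoC (ln (INR n)))%C with
    (- a * RtoC (ln (INR n)) + - b * RtoC (ln (INR n)))%C by ring.
  rewrite Cexp_plus.
  assert (H := Cbeta_Crising a b (S n) Ha Hb).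
  assert (Hf : RtoC (INR (fact n)) <> RtoC 0) by (apply RtoC_nz, INR_fact_neq_0).
  set (ea := Cexp (- a * _)); set (eb := Cexp (- b * _)).
  transitivity ((Cbeta a b * Crising b (S n)) * (Crising a (S n) * ea * eb)
    / (RtoC (INR (fact n)) * RtoC (INR (fact n))))%C; [rewrite H | ]; field; trivial.
Qed.

(** * Convergence criterion and the scalar expansion *)

(* Cauchy criterion at the end point [0] along the intervals [[a, c a]]. *)
Lemma int01_scaling_small (f : R -> C) (c m : R) : 1 < c -> 0 < m ->
  (forall a, 0 < a -> c * a < 1 -> exists J,
     is_RInt (V := C_R_CompleteNormedModule) f a (c * a) J /\ m <= Cmod J) ->
  ~ Cex_int01 f.
Proof.
intros Hc Hm HJ [l Hl].
assert (Hm2 : 0 < m / 2) by lra.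
assert (Hb := Hl _ (locally_ball_norm (V := C_R_CompleteNormedModule) l (mkposreal _ Hm2))).
unfold filtermapi in Hb; destruct Hb as [Q1 Q2 [d Hd] HQ2 HQ].
destruct (filter_ex (F := at_left 1) _ (filter_and _ _ at_left_1_Ioo HQ2)) as [b [_ H2b]].
(* Chosen so that [a] and [c * a = Rmin d 1 / 2] both lie below [d] and below 1. *)
set (a := Rmin d 1 / (2 * c)).
assert (Hmin : 0 < Rmin d 1 <= 1 /\ Rmin d 1 <= d).
{ repeat split; [apply Rmin_glb_lt; [apply cond_pos | lra] | apply Rmin_r | apply Rmin_l]. }
assert (Ha : 0 < a) by (apply Rdiv_lt_0_compat; lra).
assert (Hca : c * a = Rmin d 1 / 2) by (unfold a; field; lra).
assert (Hac : a < c * a) by nra.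
assert (HQ1 : forall t, 0 < t < d -> Q1 t).
{ intros t Ht; apply Hd; [ | lra].
  unfold ball; simpl; unfold AbsRing_ball, abs, minus, plus, opp; simpl.
  rewrite Rabs_pos_eq; lra. }
destruct (HQ a b (HQ1 a ltac:(lra)) H2b) as [y1 [Hy1 By1]].
destruct (HQ (c * a) b (HQ1 (c * a) ltac:(lra)) H2b) as [y2 [Hy2 By2]].
destruct (HJ a Ha ltac:(lra)) as [J [HJ1 HJ2]].
simpl in *; unfold ball_norm in *; rewrite norm_C_R in By1, By2.
change (Cmod (y1 - l)%C < m / 2) in By1; change (Cmod (y2 - l)%C < m / 2) in By2.
assert (E : y1 = (J + y2)%C).
{ rewrite <- (is_RInt_unique (V := C_R_CompleteNormedModule) _ _ _ _ Hy1).
  apply (is_RInt_unique (V := C_R_CompleteNormedModule)).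
  now apply (is_RInt_Chasles (V := C_R_CompleteNormedModule) _ _ (c * a)). }
replace J with ((y1 - l) + - (y2 - l))%C in HJ2 by (rewrite E; ring).
assert (HT := Cmod_triangle (y1 - l) (- (y2 - l))); rewrite Cmod_opp in HT.
apply (Rlt_irrefl m), Rle_lt_trans with (1 := HJ2), Rle_lt_trans with (1 := HT).
replace m with (m / 2 + m / 2) by field; now apply Rplus_lt_compat.
Qed.

(** For [Re d < 0] the modulus of [Cexp d] is below 1, so [r = 1] works. For [d = i y] the half-turn
    [r = PI / |y|] gives -1. The scaling factor is then [c = exp r], with [c^d] different from 1. *)
Lemma Cexp_scaling_neq_1 (d : C) : Re d <= 0 -> d <> RtoC 0 ->
  exists r, 0 < r /\ Cexp (d * RtoC r) <> RtoC 1.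
Proof.
intros Hd Hd0; destruct d as [x y]; simpl in Hd.
destruct (Rlt_le_dec x 0) as [Hx | Hx].
- exists 1; split; [lra | intros H].
  apply (f_equal Cmod) in H; rewrite Cmod_Cexp, Cmod_1 in H.
  assert (H' : exp (Re ((x, y) * 1)%C) = exp 0) by (rewrite exp_0; exact H).
  apply exp_inv in H'; simpl in H'; lra.
- assert (Hy : y <> 0) by (intros ->; apply Hd0; unfold RtoC; f_equal; lra).
  exists (PI / Rabs y); split.
  { apply Rdiv_lt_0_compat; [apply PI_RGT_0 | now apply Rabs_pos_lt]. }
  intros H; apply (f_equal Re) in H; revert H; unfold Cexp; simpl.
  replace (x * (PI / Rabs y) - y * 0) with 0 by (replace x with 0 by lra; ring).
  rewrite exp_0, Rmult_1_l, Rmult_0_r, Rplus_0_l.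
  unfold Rabs; destruct (Rcase_abs y).
  + replace (y * (PI / - y)) with (- PI) by (field; trivial).
    rewrite cos_neg, cos_PI; lra.
  + replace (y * (PI / y)) with PI by (field; trivial).
    rewrite cos_PI; lra.
Qed.

(** If [Re d <= 0] and [d] is nonzero, the integral over [[a, c a]] is [a^d (c^d - 1) / d], with
    [|a^d| >= 1] as [a < 1]. The case [d = 0] is separate, the primitive being [ln]: there every
    integral over [[a, 2 a]] equals [ln 2]. *)
Lemma Re_pos_of_ex_int01 (d : C) : Cex_int01 (beta_kernel (d - 1) 0) -> 0 < Re d.
Proof.
intros Hex; apply Rnot_le_lt; intros Hd; revert Hex.
destruct (Ceq_dec d (RtoC 0)) as [-> | Hd0].
- apply int01_scaling_small with 2 (ln 2); [lra | rewrite <- ln_1; apply ln_increasing; lra | ].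
  intros a Ha Ha1; exists (RtoC (ln 2)); split.
  2:{ rewrite Cmod_R; apply Rle_abs. }
  replace (RtoC (ln 2)) with (RtoC (ln (2 * a)) - RtoC (ln a))%C
    by (rewrite <- RtoC_minus, ln_mult by lra; f_equal; ring).
  apply (is_RInt_derive (V := C_R_CompleteNormedModule) (fun t => RtoC (ln t)));
    rewrite Rmin_left, Rmax_right by lra; intros t Ht.
  + replace (beta_kernel (0 - 1) 0 t) with ((/ t, 0) : C).
    { apply is_derive_C; auto_derive; trivial; lra. }
    unfold beta_kernel.
    replace ((0 - 1) * RtoC (ln t) + 0 * RtoC (ln (1 - t)))%C with (RtoC (- ln t))
      by (rewrite RtoC_opp; ring).
    rewrite Cexp_R, exp_Ropp, exp_ln by lra; reflexivity.
  + apply continuous_beta_kernel; lra.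
- destruct (Cexp_scaling_neq_1 d Hd Hd0) as [r [Hr Hr1]].
  set (w := ((Cexp (d * RtoC r) - 1) / d)%C).
  assert (Hw : w <> RtoC 0).
  { unfold w, Cdiv; apply Cmult_neq_0; [now apply Cminus_eq_contra | ].
    intros H; apply C1_nz; rewrite <- (Cinv_r d Hd0), H; ring. }
  apply int01_scaling_small with (exp r) (Cmod w).
  + rewrite <- exp_0; now apply exp_increasing.
  + now apply Cmod_gt_0.
  + intros a Ha Ha1; exists (beta_kernel d 0 a * w)%C.
    assert (Her : 1 < exp r) by (rewrite <- exp_0; now apply exp_increasing).
    split.
    * replace (beta_kernel d 0 a * w)%C with
        (/ d * (beta_kernel d 0 (exp r * a) - beta_kernel d 0 a))%C.
      2:{ unfold beta_kernel, w; rewrite !Cmult_0_l, !Cplus_0_r.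
          rewrite ln_mult, ln_exp, RtoC_plus by (try apply exp_pos; lra).
          replace (d * (RtoC r + RtoC (ln a)))%C with (d * RtoC r + d * RtoC (ln a))%C by ring.
          rewrite Cexp_plus; field; assumption. }
      apply (is_RInt_ext (V := C_R_NormedModule)) with
        (fun t => / d * (d * beta_kernel (d - 1) 0 t))%C.
      { intros t _; change ((/ d * (d * beta_kernel (d - 1) 0 t))%C = beta_kernel (d - 1) 0 t).
        field; assumption. }
      apply is_RInt_Cmult.
      apply (is_RInt_derive (V := C_R_CompleteNormedModule) (beta_kernel d 0));
        rewrite Rmin_left, Rmax_right by nra; intros t Ht.
      -- replace (d * beta_kernel (d - 1) 0 t)%C with
           (d * beta_kernel (d - 1) 0 t - 0 * beta_kernel d (0 - 1) t)%C by ring.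
         apply is_derive_beta_kernel; lra.
      -- apply (filterlim_comp _ _ _ _ (fun z : C => d * z)%C _ _ _
           (continuous_beta_kernel (d - 1) 0 t ltac:(lra))).
         apply (filterlim_scal_r (V := C_NormedModule)).
    * rewrite Cmod_mult, Cmod_beta_kernel, <- (Rmult_1_l (Cmod w)) at 1.
      apply Rmult_le_compat_r; [apply Cmod_ge_0 | ].
      apply Rle_trans with (exp 0); [rewrite exp_0; apply Rle_refl | ].
      apply exp_le_exp; rewrite re_RtoC, Rmult_0_l, Rplus_0_r.
      assert (ln a < 0) by (apply ln_le_0; nra); nra.
Qed.

(** * Complex powers and the scalar components of the expansion *)

Lemma Cpower_pos (log : C -> C) (x : R) (nu : C) : is_log_branch log -> 0 < x ->
  Cpower log (RtoC x) nu = Cexp (nu * RtoC (ln x)).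
Proof.
intros [_ Hlog] Hx; unfold Cpower.
destruct (Ceq_dec (RtoC x) (RtoC 0)) as [H | H].
- now elim (RtoC_nz x ltac:(lra)).
- now rewrite Hlog.
Qed.

Lemma Cexp_mult_nat (n : nat) (z : C) : Cexp (RtoC (INR n) * z) = (Cexp z ^ n)%C.
Proof.
induction n as [ | n IH].
- simpl; now rewrite Cmult_0_l, Cexp_0.
- rewrite RtoC_S; replace ((RtoC (INR n) + 1) * z)%C with (z + RtoC (INR n) * z)%C by ring.
  now rewrite Cexp_plus, IH.
Qed.

(** Off 0, any branch works because [exp (n log w) = w^n]. At [w = 0], [0 < Re mu] keeps both
    exponents away from 0, so both powers take the value 0; this covers non-invertible [Z]. *)
Lemma Cpower_plus_nat (log : C -> C) (w mu : C) (n : nat) : is_log_branch log ->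
  0 < Re mu -> Cpower log w (mu + RtoC (INR n)) = (Cpower log w mu * w ^ n)%C.
Proof.
intros [Hlog _] Hmu; unfold Cpower; destruct (Ceq_dec w (RtoC 0)) as [H | H].
- assert (H1 : mu <> RtoC 0) by (intros ->; simpl in Hmu; lra).
  assert (H2 : (mu + RtoC (INR n))%C <> RtoC 0).
  { intros E; apply (f_equal Re) in E; rewrite Re_plus_INR in E; simpl in E.
    generalize (pos_INR n); lra. }
  destruct (Ceq_dec mu (RtoC 0)); [contradiction | ].
  destruct (Ceq_dec (mu + RtoC (INR n)) (RtoC 0)); [contradiction | ring].
- rewrite Cmult_plus_distr_r, Cexp_plus, Cexp_mult_nat, Hlog by assumption; reflexivity.
Qed.

(** The common shape of both idempotent components of [u_integrand]; [1 - RtoC t] is the form in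
    which the projection produces it. *)
Definition u_comp (log : C -> C) (nu delta : C) (s : nat) (t : R) : C :=
  (Cpower log (RtoC t) (nu - 1) * Cpower log (1 - RtoC t) (delta + RtoC (INR s)))%C.

Definition v_comp (log : C -> C) (delta : C) (s : nat) (t : R) : C :=
  (Cpower log (RtoC t) (delta - 1) * (RtoC t - 1) ^ s)%C.

Lemma u_comp_beta_kernel (log : C -> C) (nu delta : C) (s : nat) (t : R) :
  is_log_branch log -> 0 < t < 1 ->
  u_comp log nu delta s t = beta_kernel (nu - 1) (delta + RtoC (INR (S s)) - 1) t.
Proof.
intros Hlog Ht; unfold u_comp.
rewrite <- RtoC_minus, !Cpower_pos, <- Cexp_plus by (trivial; lra).
unfold beta_kernel; f_equal; rewrite RtoC_S; ring.
Qed.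

Lemma v_comp_beta_kernel (log : C -> C) (delta : C) (s : nat) (t : R) :
  is_log_branch log -> 0 < t < 1 ->
  v_comp log delta s t =
    (RtoC ((-1) ^ s) * beta_kernel (delta - 1) (1 + RtoC (INR s) - 1) t)%C.
Proof.
intros Hlog Ht; unfold v_comp, beta_kernel.
rewrite !Cpower_pos by (trivial; lra).
replace (1 + RtoC (INR s) - 1)%C with (RtoC (INR s)) by ring.
rewrite Cexp_plus, Cexp_mult_nat, Cexp_R, exp_ln by lra.
rewrite RtoC_pow.
replace (RtoC t - 1)%C with (RtoC (-1) * RtoC (1 - t))%C
  by (rewrite RtoC_minus; replace (-1) with (- (1)) by ring; rewrite RtoC_opp; ring).
rewrite Cpow_mult_l; ring.
Qed.

Lemma is_int01_u_comp (log : C -> C) (nu delta : C) (s : nat) :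
  is_log_branch log -> 0 < Re nu -> 0 < Re delta ->
  is_int01 (u_comp log nu delta s) (Cbeta nu (delta + RtoC (INR (S s)))).
Proof.
intros Hlog Hn Hd; apply is_int01_ext with (2 := is_int01_Cbeta nu (delta + RtoC (INR (S s)))
  Hn ltac:(rewrite Re_plus_INR, S_INR; generalize (pos_INR s); lra)).
intros t Ht; symmetry; now apply u_comp_beta_kernel.
Qed.

Lemma is_int01_v_comp (log : C -> C) (delta : C) (s : nat) :
  is_log_branch log -> 0 < Re delta ->
  is_int01 (v_comp log delta s) (RtoC ((-1) ^ s) * Cbeta delta (1 + RtoC (INR s))).
Proof.
intros Hlog Hd; apply is_int01_ext with
  (2 := is_int01_Cmult (RtoC ((-1) ^ s)) _ _ (is_int01_Cbeta delta (1 + RtoC (INR s))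
  Hd ltac:(rewrite Re_plus_INR; simpl; generalize (pos_INR s); lra))).
intros t Ht; symmetry; now apply v_comp_beta_kernel.
Qed.

Lemma Re_pos_of_ex_v_comp (log : C -> C) (delta : C) : is_log_branch log ->
  Cex_int01 (v_comp log delta 0) -> 0 < Re delta.
Proof.
intros Hlog [l Hl]; apply Re_pos_of_ex_int01; exists l.
apply is_int01_ext with (2 := Hl); intros t Ht.
rewrite v_comp_beta_kernel by assumption; simpl.
rewrite Cmult_1_l; f_equal; ring.
Qed.

(** [Gamma(delta+s+1)] cancels between the two beta values. The second one is [s! / (delta)_{s+1}],
    and [(delta)_{s+1}] turns [1 / Gamma(delta)] into [1 / Gamma(delta+s+1)]; the beta identity is
    used only for the first. *)
Lemma Cbeta_pair_Crgamma (nu delta : C) (s : nat) : 0 < Re nu -> 0 < Re delta ->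
  (Crgamma nu * Crgamma delta
   * (Cbeta nu (delta + RtoC (INR (S s))) * Cbeta delta (1 + RtoC (INR s)))
   = RtoC (INR (fact s)) * Crgamma (nu + delta + RtoC (INR s) + 1))%C.
Proof.
intros Hn Hd.
rewrite (Crgamma_Crising delta (S s) Hd), <- (Cbeta_S_Crising delta s Hd).
replace (nu + delta + RtoC (INR s) + 1)%C with (nu + (delta + RtoC (INR (S s))))%C
  by (rewrite RtoC_S; ring).
rewrite <- (Cbeta_Crgamma nu (delta + RtoC (INR (S s))) Hn)
  by (rewrite Re_plus_INR, S_INR; generalize (pos_INR s); lra).
ring.
Qed.

Definition bessel_comp (log : C -> C) (mu z : C) (s : nat) : C :=
  (RtoC ((-1) ^ s / INR (fact s)) * Crgamma (mu + RtoC (INR s) + 1)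
   * Cpower log (RtoC (1 / 2) * z) (mu + RtoC (2 * INR s)))%C.

Definition expansion_comp (log : C -> C) (nu delta z : C) (s : nat) : C :=
  (RtoC (/ (4 ^ s * INR (fact s) ^ 2)) * z ^ (2 * s)
   * (Cint01 (u_comp log nu delta s) * Cint01 (v_comp log delta s)))%C.

Lemma bessel_comp_expansion (log : C -> C) (nu delta z : C) (s : nat) :
  is_log_branch log -> 0 < Re nu -> 0 < Re delta ->
  bessel_comp log (nu + delta) z s =
    (Crgamma nu * Crgamma delta * Cpower log (RtoC (1 / 2) * z) (nu + delta)
     * expansion_comp log nu delta z s)%C.
Proof.
intros Hlog Hn Hd; unfold bessel_comp, expansion_comp.
rewrite (is_int01_unique _ _ (is_int01_u_comp log nu delta s Hlog Hn Hd)).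
rewrite (is_int01_unique _ _ (is_int01_v_comp log delta s Hlog Hd)).
assert (H2s : 2 * INR s = INR (2 * s)) by (rewrite mult_INR; reflexivity).
rewrite H2s.
(* Splits [(z/2)^(nu+delta+2s)] into the prefactor and [z^(2s) / 4^s]. The sign comes from the
   v-integral, and the [s!] of the beta pair cancels one of the two factorials. *)
rewrite Cpower_plus_nat by (trivial; destruct nu, delta; simpl in *; lra).
assert (HP := Cbeta_pair_Crgamma nu delta s Hn Hd).
set (P := Cpower _ _ _).
set (B1 := Cbeta nu _) in *; set (B2 := Cbeta delta _) in *.
assert (Hf : INR (fact s) <> 0) by apply INR_fact_neq_0.
assert (Hf' := RtoC_nz _ Hf).
assert (H4 : 4 ^ s <> 0) by (apply pow_nonzero; lra).
rewrite Cpow_mult_l, (Cpow_mult_r (RtoC (1 / 2))), <- RtoC_pow.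
replace ((1 / 2) ^ 2) with (/ 4) by field.
rewrite <- RtoC_pow, pow_inv.
transitivity (RtoC (/ (4 ^ s * INR (fact s) ^ 2)) * z ^ (2 * s) * RtoC ((-1) ^ s) * P
  * (Crgamma nu * Crgamma delta * (B1 * B2)))%C; [rewrite HP | ring].
unfold Rdiv.
replace (/ (4 ^ s * INR (fact s) ^ 2)) with (/ 4 ^ s * / INR (fact s) * / INR (fact s))
  by (field; split; assumption).
rewrite !RtoC_mult, (RtoC_inv (INR (fact s))) by assumption.
field; assumption.
Qed.

(** The beta values are bounded uniformly in [s], so the terms are at most [K x^s / s!] with
    [x = |z|^2 / 4]; one of the two factorials already suffices for comparison with the exponential
    series. *)
Lemma ex_series_expansion_comp (log : C -> C) (nu delta z : C) :
  is_log_branch log -> 0 < Re nu -> 0 < Re delta ->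
  exists l, is_series (V := C_NormedModule) (expansion_comp log nu delta z) l.
Proof.
intros Hlog Hn Hd.
set (x := Cmod z ^ 2 / 4); set (K := 1 / Re nu * (1 / Re delta)).
assert (Hx : 0 <= x) by (apply Rdiv_le_0_compat; [apply pow2_ge_0 | lra]).
apply (ex_series_le (V := C_CompleteNormedModule) _ (fun s => K * (/ INR (fact s) * x ^ s))).
2:{ apply (ex_series_scal (V := R_NormedModule)).
    exists (exp x); generalize (is_exp_Reals x); apply is_series_ext.
    intros n; rewrite pow_n_pow; unfold scal; simpl; unfold mult; simpl; ring. }
intros s; change (Cmod (expansion_comp log nu delta z s) <= K * (/ INR (fact s) * x ^ s)).
unfold expansion_comp.
rewrite (is_int01_unique _ _ (is_int01_u_comp log nu delta s Hlog Hn Hd)).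
rewrite (is_int01_unique _ _ (is_int01_v_comp log delta s Hlog Hd)).
assert (H1 := Cmod_Cbeta_le nu (delta + RtoC (INR (S s))) Hn
  ltac:(rewrite Re_plus_INR, S_INR; generalize (pos_INR s); lra)).
assert (H2 := Cmod_Cbeta_le delta (1 + RtoC (INR s)) Hd
  ltac:(rewrite Re_plus_INR; simpl; generalize (pos_INR s); lra)).
rewrite !Cmod_mult, !Cmod_R, pow_1_abs, Rmult_1_l.
assert (Hf : 1 <= INR (fact s)) by (apply one_le_INR, lt_O_fact).
assert (H4 : 0 < 4 ^ s) by (apply pow_lt; lra).
rewrite Rmult_comm; apply Rmult_le_compat.
- apply Rmult_le_pos; apply Cmod_ge_0.
- apply Rmult_le_pos; [apply Rabs_pos | apply Cmod_ge_0].
- apply Rmult_le_compat; trivial; apply Cmod_ge_0.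
- rewrite Cmod_pow, pow_mult, Rabs_pos_eq.
  2:{ left; apply Rinv_0_lt_compat; apply Rmult_lt_0_compat; [lra | apply pow_lt; lra]. }
  unfold x, Rdiv; rewrite Rpow_mult_distr, pow_inv.
  rewrite Rinv_mult.
  rewrite (Rmult_comm ((Cmod z ^ 2) ^ s)), <- Rmult_assoc.
  apply Rmult_le_compat_r; [apply pow_le, pow2_ge_0 | ].
  rewrite (Rmult_comm (/ INR (fact s))).
  apply Rmult_le_compat_l; [left; now apply Rinv_0_lt_compat | ].
  apply Rinv_le_contravar; [lra | nra].
Qed.

(** * Bicomplex assembly *)

Lemma BC_ext (x y : BC) : idem1 x = idem1 y -> idem2 x = idem2 y -> x = y.
Proof.
intros H1 H2; now rewrite <- (of_idem_idem x), <- (of_idem_idem y), H1, H2.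
Qed.

Lemma Ci2 : (Ci * Ci = - (1))%C.
Proof. apply injective_projections; simpl; ring. Qed.

Lemma idem1_mult (x y : BC) : idem1 (x * y)%BC = (idem1 x * idem1 y)%C.
Proof.
destruct x as [a b], y as [c d]; unfold idem1, BCmult; cbn [fst snd].
replace ((a - Ci * b) * (c - Ci * d))%C with
  (a * c + Ci * Ci * (b * d) - Ci * (a * d + b * c))%C by ring.
rewrite Ci2; ring.
Qed.

Lemma idem2_mult (x y : BC) : idem2 (x * y)%BC = (idem2 x * idem2 y)%C.
Proof.
destruct x as [a b], y as [c d]; unfold idem2, BCmult; cbn [fst snd].
replace ((a + Ci * b) * (c + Ci * d))%C with
  (a * c + Ci * Ci * (b * d) + Ci * (a * d + b * c))%C by ring.
rewrite Ci2; ring.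
Qed.

Lemma idem1_plus (x y : BC) : idem1 (x + y)%BC = (idem1 x + idem1 y)%C.
Proof. unfold idem1, BCplus; cbn [fst snd]; ring. Qed.

Lemma idem2_plus (x y : BC) : idem2 (x + y)%BC = (idem2 x + idem2 y)%C.
Proof. unfold idem2, BCplus; cbn [fst snd]; ring. Qed.

Lemma idem1_minus (x y : BC) : idem1 (x - y)%BC = (idem1 x - idem1 y)%C.
Proof. unfold idem1, BCminus, BCopp, BCplus; cbn [fst snd]; ring. Qed.

Lemma idem2_minus (x y : BC) : idem2 (x - y)%BC = (idem2 x - idem2 y)%C.
Proof. unfold idem2, BCminus, BCopp, BCplus; cbn [fst snd]; ring. Qed.

Lemma idem1_BCofC (z : C) : idem1 (BCofC z) = z.
Proof. unfold idem1, BCofC; cbn [fst snd]; ring. Qed.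

Lemma idem2_BCofC (z : C) : idem2 (BCofC z) = z.
Proof. unfold idem2, BCofC; cbn [fst snd]; ring. Qed.

Lemma idem1_BCofR (x : R) : idem1 (BCofR x) = RtoC x.
Proof. apply idem1_BCofC. Qed.

Lemma idem2_BCofR (x : R) : idem2 (BCofR x) = RtoC x.
Proof. apply idem2_BCofC. Qed.

Lemma idem1_pow (x : BC) (n : nat) : idem1 (x ^ n)%BC = (idem1 x ^ n)%C.
Proof.
induction n as [ | n IH]; simpl; [apply idem1_BCofR | now rewrite idem1_mult, IH].
Qed.

Lemma idem2_pow (x : BC) (n : nat) : idem2 (x ^ n)%BC = (idem2 x ^ n)%C.
Proof.
induction n as [ | n IH]; simpl; [apply idem2_BCofR | now rewrite idem2_mult, IH].
Qed.

#[local] Hint Rewrite idem1_mult idem2_mult idem1_plus idem2_plus idem1_minus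
  idem2_minus idem1_BCofC idem2_BCofC idem1_BCofR idem2_BCofR idem1_pow idem2_pow
  idem1_of_idem idem2_of_idem : idem.

Lemma idem1_bcj : idem1 bcj = (- Ci)%C.
Proof. unfold idem1, bcj; cbn [fst snd]; ring. Qed.

Lemma idem2_bcj : idem2 bcj = Ci.
Proof. unfold idem2, bcj; cbn [fst snd]; ring. Qed.

Lemma sum_n_pair (a : nat -> BC) (n : nat) :
  sum_n (G := prod_NormedModule C_AbsRing C_NormedModule C_NormedModule) a n =
  (sum_n (G := C_NormedModule) (fun s => fst (a s)) n,
   sum_n (G := C_NormedModule) (fun s => snd (a s)) n).
Proof.
induction n as [ | n IH].
- rewrite !sum_O; now destruct (a 0%nat).
- now rewrite !sum_Sn, IH.
Qed.

Lemma is_series_pair (a : nat -> BC) (l1 l2 : C) :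
  is_series (V := C_NormedModule) (fun s => fst (a s)) l1 ->
  is_series (V := C_NormedModule) (fun s => snd (a s)) l2 ->
  is_series (V := prod_NormedModule C_AbsRing C_NormedModule C_NormedModule) a (l1, l2).
Proof.
intros H1 H2 P [eps HP].
generalize (filter_and (F := eventually) _ _
  (proj1 (filterlim_locally (F := eventually) (sum_n (G := C_NormedModule)
     (fun s => fst (a s))) l1) H1 eps)
  (proj1 (filterlim_locally (F := eventually) (sum_n (G := C_NormedModule)
     (fun s => snd (a s))) l2) H2 eps)).
unfold filtermap; apply filter_imp; intros n [Hn1 Hn2]; apply HP.
rewrite sum_n_pair; split; assumption.
Qed.

Lemma CSeries_unique (a : nat -> C) (l : C) :
  is_series (V := C_NormedModule) a l -> CSeries a = l.
Proof.
apply (iota_filterlim_locally (V := C_CompleteNormedModule) (F := eventually)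
  (sum_n (G := C_NormedModule) a) l).
Qed.

(** [BCSeries] sums the coordinates with respect to 1 and [j], while the analysis is done in
    idempotent components; the two are linked by [fst = (idem1 + idem2) / 2] and
    [snd = i (idem1 - idem2) / 2]. *)
Lemma BCSeries_of_idem (a : nat -> BC) (l1 l2 : C) :
  is_series (V := C_NormedModule) (fun s => idem1 (a s)) l1 ->
  is_series (V := C_NormedModule) (fun s => idem2 (a s)) l2 ->
  BCex_series a /\ BCSeries a = of_idem l1 l2.
Proof.
intros H1 H2; set (h := RtoC (1 / 2)).
assert (Hh : (h + h = 1)%C) by (unfold h; rewrite <- RtoC_plus; f_equal; field).
assert (Hf : is_series (V := C_NormedModule) (fun s => fst (a s)) (h * (l1 + l2))%C).
{ generalize (is_series_scal (V := C_NormedModule) h _ _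
    (is_series_plus (V := C_NormedModule) _ _ _ _ H1 H2)).
  apply is_series_ext; intros n.
  change ((h * (idem1 (a n) + idem2 (a n)))%C = fst (a n)); unfold idem1, idem2.
  transitivity ((h + h) * fst (a n))%C; [ring | rewrite Hh; ring]. }
assert (Hs : is_series (V := C_NormedModule) (fun s => snd (a s)) (h * Ci * (l1 - l2))%C).
{ generalize (is_series_scal (V := C_NormedModule) (h * Ci)%C _ _
    (is_series_minus (V := C_NormedModule) _ _ _ _ H1 H2)).
  apply is_series_ext; intros n.
  change ((h * Ci * (idem1 (a n) - idem2 (a n)))%C = snd (a n)); unfold idem1, idem2.
  transitivity (- (Ci * Ci) * (h + h) * snd (a n))%C; [ring | rewrite Hh, Ci2; ring]. }
split.
- exists (h * (l1 + l2), h * Ci * (l1 - l2))%C; now apply is_series_pair.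
- unfold BCSeries; rewrite (CSeries_unique _ _ Hf), (CSeries_unique _ _ Hs).
  apply BC_ext; autorewrite with idem; unfold idem1, idem2; cbn [fst snd].
  + transitivity (h * (l1 + l2) - Ci * Ci * h * (l1 - l2))%C; [ring | ].
    rewrite Ci2; transitivity ((h + h) * l1)%C; [ring | rewrite Hh; ring].
  + transitivity (h * (l1 + l2) + Ci * Ci * h * (l1 - l2))%C; [ring | ].
    rewrite Ci2; transitivity ((h + h) * l2)%C; [ring | rewrite Hh; ring].
Qed.

Lemma comp1_u_integrand (log : C -> C) (V delta : BC) (s : nat) :
  comp1 (u_integrand log V delta s) = u_comp log (idem1 V) (idem1 delta) s.
Proof.
apply functional_extensionality; intros t.
unfold comp1, u_integrand, BCpower, u_comp; now autorewrite with idem.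
Qed.

Lemma comp2_u_integrand (log : C -> C) (V delta : BC) (s : nat) :
  comp2 (u_integrand log V delta s) = u_comp log (idem2 V) (idem2 delta) s.
Proof.
apply functional_extensionality; intros t.
unfold comp2, u_integrand, BCpower, u_comp; now autorewrite with idem.
Qed.

Lemma comp1_v_integrand (log : C -> C) (delta : BC) (s : nat) :
  comp1 (v_integrand log delta s) = v_comp log (idem1 delta) s.
Proof.
apply functional_extensionality; intros t.
unfold comp1, v_integrand, BCpower, v_comp; now autorewrite with idem.
Qed.

Lemma comp2_v_integrand (log : C -> C) (delta : BC) (s : nat) :
  comp2 (v_integrand log delta s) = v_comp log (idem2 delta) s.
Proof.
apply functional_extensionality; intros t.
unfold comp2, v_integrand, BCpower, v_comp; now autorewrite with idem.
Qed.

Lemma idem1_bessel_term (log : C -> C) (V Z : BC) (s : nat) :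
  idem1 (bessel_term log V Z s) = bessel_comp log (idem1 V) (idem1 Z) s.
Proof.
unfold bessel_term, BCrgamma, BCpower, bessel_comp; now autorewrite with idem.
Qed.

Lemma idem2_bessel_term (log : C -> C) (V Z : BC) (s : nat) :
  idem2 (bessel_term log V Z s) = bessel_comp log (idem2 V) (idem2 Z) s.
Proof.
unfold bessel_term, BCrgamma, BCpower, bessel_comp; now autorewrite with idem.
Qed.

Lemma idem1_expansion_term (log : C -> C) (V delta Z : BC) (s : nat) :
  idem1 (expansion_term log V delta Z s)
  = expansion_comp log (idem1 V) (idem1 delta) (idem1 Z) s.
Proof.
unfold expansion_term, BCint01, expansion_comp; autorewrite with idem.
now rewrite comp1_u_integrand, comp1_v_integrand.
Qed.

Lemma idem2_expansion_term (log : C -> C) (V delta Z : BC) (s : nat) :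
  idem2 (expansion_term log V delta Z s)
  = expansion_comp log (idem2 V) (idem2 delta) (idem2 Z) s.
Proof.
unfold expansion_term, BCint01, expansion_comp; autorewrite with idem.
now rewrite comp2_u_integrand, comp2_v_integrand.
Qed.

Lemma is_series_bessel_comp (log : C -> C) (nu delta z l : C) :
  is_log_branch log -> 0 < Re nu -> 0 < Re delta ->
  is_series (V := C_NormedModule) (expansion_comp log nu delta z) l ->
  is_series (V := C_NormedModule) (bessel_comp log (nu + delta) z)
    (Crgamma nu * Crgamma delta * Cpower log (RtoC (1 / 2) * z) (nu + delta) * l)%C.
Proof.
intros Hlog Hn Hd Hl.
generalize (is_series_scal (V := C_NormedModule)
  (Crgamma nu * Crgamma delta * Cpower log (RtoC (1 / 2) * z) (nu + delta))%C _ _ Hl).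
apply is_series_ext; intros s; symmetry; now apply bessel_comp_expansion.
Qed.

Theorem theorem3p3 (log : C -> C) (Hlog : is_log_branch log)
  (Z V delta : BC) (alpha1 alpha2 beta1 beta2 : C)
  (HV : V = (BCofC alpha1 + bcj * BCofC alpha2)%BC)
  (Hdelta : delta = (BCofC beta1 + bcj * BCofC beta2)%BC)
  (Halpha : (Re alpha1 > Rabs (Im alpha2))%R)
  (Hbeta : (Re beta1 + 1 > Rabs (Im beta2))%R)
  (* the v-integrals on the right-hand side converge *)
  (Hv : forall s : nat, BCex_int01 (v_integrand log delta s)) :
  (forall s : nat, BCex_int01 (u_integrand log V delta s)) /\
  BCex_series (bessel_term log (V + delta)%BC Z) /\
  BCex_series (expansion_term log V delta Z) /\
  BCbessel log (V + delta)%BC Z =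
    (BCrgamma V * BCrgamma delta
     * BCpower log (BCofR (1 / 2) * Z) (V + delta)
     * BCSeries (expansion_term log V delta Z))%BC.
Proof.
assert (HV12 : 0 < Re (idem1 V) /\ 0 < Re (idem2 V)).
(* The real parts of the components are [Re alpha1 + Im alpha2] and [Re alpha1 - Im alpha2]. *)
{ rewrite HV; autorewrite with idem; rewrite idem1_bcj, idem2_bcj.
  destruct alpha1 as [p q], alpha2 as [r s]; simpl in *.
  apply Rgt_lt, Rabs_def2 in Halpha; lra. }
destruct HV12 as [HV1 HV2]; clear HV Hdelta Halpha Hbeta.
assert (Hd1 : 0 < Re (idem1 delta)).
{ apply (Re_pos_of_ex_v_comp log); trivial; rewrite <- comp1_v_integrand; apply (Hv 0%nat). }
assert (Hd2 : 0 < Re (idem2 delta)).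
{ apply (Re_pos_of_ex_v_comp log); trivial; rewrite <- comp2_v_integrand; apply (Hv 0%nat). }
destruct (ex_series_expansion_comp log _ _ (idem1 Z) Hlog HV1 Hd1) as [l1 Hl1].
destruct (ex_series_expansion_comp log _ _ (idem2 Z) Hlog HV2 Hd2) as [l2 Hl2].
assert (Hb1 := is_series_bessel_comp log _ _ _ _ Hlog HV1 Hd1 Hl1).
assert (Hb2 := is_series_bessel_comp log _ _ _ _ Hlog HV2 Hd2 Hl2).
rewrite <- idem1_plus in Hb1; rewrite <- idem2_plus in Hb2.
destruct (BCSeries_of_idem (expansion_term log V delta Z) l1 l2) as [He He'].
{ revert Hl1; apply is_series_ext; intros s; now rewrite idem1_expansion_term. }
{ revert Hl2; apply is_series_ext; intros s; now rewrite idem2_expansion_term. }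
destruct (BCSeries_of_idem (bessel_term log (V + delta)%BC Z) _ _
  (is_series_ext _ _ _ (fun s => eq_sym (idem1_bessel_term log (V + delta)%BC Z s)) Hb1)
  (is_series_ext _ _ _ (fun s => eq_sym (idem2_bessel_term log (V + delta)%BC Z s)) Hb2))
  as [Hb Hb'].
repeat split; trivial.
- rewrite comp1_u_integrand; eexists; now apply is_int01_u_comp.
- rewrite comp2_u_integrand; eexists; now apply is_int01_u_comp.
- unfold BCbessel; rewrite Hb', He'.
  apply BC_ext; unfold BCrgamma, BCpower; now autorewrite with idem.
Qed.
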